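(* Let $X$ be an infinite Tychonoff space. Then $X$ is skeletally Dugundji if and only if there exists an additive $c$-club $\mathcal C$ on $X$.
   Context: All spaces considered as domains are infinite Tychonoff spaces; all maps are continuous; the weight $w(Y)$ of a space is by convention always an infinite cardinal (i.e. $\max$ of $\aleph_0$ and the least cardinality of a base). Maps. A map $f:X\to Y$ is skeletal if $\operatorname{Int}\overline{f[U]}\neq\varnothing$ for every nonempty open $U\subseteq X$. Maps $f:X\to Y$ and $g:X\to Z$ are homeomorphic if there is a homeomorphism $h:Z\to Y$ with $f=h\circ g$. For maps $\phi,g$ defined on $X$, write $\phi\prec g$ if there is a map $h:\phi[X]\to g[X]$ with $g=h\circ\phi$. Every map in the lattices below, and every diagonal product, is regarded as a map onto its image. Multiplicative lattice. A family $\Psi$ of maps with common domain $X$ is a multiplicative lattice if: (L1) for any map $f:X\to f[X]$ there is $\phi\in\Psi$ with $\phi\prec f$ and $w(\phi[X])\le w(f[X])$; (L2) if $\{\phi_\alpha:\alpha\in J\}\subset\Psi$, then the diagonal product $\triangle\{\phi_\alpha:\alpha\in J\}$ is homeomorphic to some element of $\Psi$. If all members of $\Psi$ are skeletal, it is a multiplicative lattice of skeletal maps. A Tychonoff space is skeletally Dugundji if it has a multiplicative lattice of skeletal maps. Families of co-zero sets. $\operatorname{coZ}(X)$ is the family of all co-zero subsets of $X$; $[\operatorname{coZ}(X)]^{\omega}$ is the collection of all countable infinite families of co-zero sets, and $[\operatorname{coZ}(X)]^{\le\omega}$ the collection of all at most countable ones. For a family $\mathcal A$ of sets, $\langle\mathcal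 A\rangle$ is the least family containing $\mathcal A$ and closed under finite intersections and finite unions. Property Seq. A family $\mathcal P$ of open sets has the property Seq if for every $W\in\mathcal P$ there are sequences $\{U_n:n\ge0\}\subseteq\mathcal P$ and $\{V_n:n\ge0\}\subseteq\mathcal P$ with $U_k\subseteq X\setminus V_k\subseteq U_{k+1}$ for each $k$ and $\bigcup_n U_n=W$. The relation $\subset_c$. $\mathcal P\subset_c\operatorname{coZ}(X)$ means $\mathcal P\subseteq\operatorname{coZ}(X)$ and for any nonempty $V\in\operatorname{coZ}(X)$ there is a nonempty $W\in\mathcal P$ such that $U\cap V\ne\varnothing$ for every nonempty $U\in\mathcal P$ with $U\subseteq W$. Clubs. A collection $\mathcal C\subseteq[\operatorname{coZ}(X)]^{\omega}$ is a club if (i) $\mathcal A_1\subseteq\mathcal A_2\subseteq\dots$ with all $\mathcal A_n\in\mathcal C$ implies $\bigcup_n\mathcal A_n\in\mathcal C$; (ii) for any $\mathcal B\in[\operatorname{coZ}(X)]^{\le\omega}$ there is $\mathcal A\in\mathcal C$ with $\mathcal B\subseteq\mathcal A$. A club $\mathcal C$ is a $c$-club if every $\mathcal P\in\mathcal C$ satisfies $\mathcal P\subset_c\operatorname{coZ}(X)$, has the property Seq, and is closed under finite unions and finite intersections. A $c$-club $\mathcal C$ is additive if $\langle\mathcal A_1\cup\mathcal A_2\rangle\in\mathcal C$ for all $\mathcal A_1,\mathcal A_2\in\mathcal C$. *)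

(* Defs.v *)
From HB Require Import structures.
From mathcomp Require Import all_boot all_order all_algebra.
From mathcomp Require Import all_classical all_reals.
From mathcomp Require Import topology normedtype.
Import numFieldNormedType.Exports.

Set Implicit Arguments.
Unset Strict Implicit.
Unset Printing Implicit Defensive.

Local Open Scope classical_set_scope.
Local Open Scope card_scope.
Local Open Scope ring_scope.

Definition tychonoff_space (T : topologicalType) : Prop :=
  completely_regular_space T /\ accessible_space T.

Definition least_base (Y : topologicalType) : set (set (set Y)) :=
  [set B | basis B /\ forall B' : set (set Y), basis B' -> B #<= B'].
Arguments least_base : clear implicits.

(* The library has no type of cardinals: the weight, max(aleph_0, |B|) for a
   base B of least cardinality, is represented by a set of that cardinality,
   to be compared through #<=. *)
Definition weight (Y : topologicalType) : set (set Y + nat) :=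
  let B := xget set0 (least_base Y) in
  if [set: nat] #<= B then inl @` B else inr @` [set: nat].
Arguments weight : clear implicits.

Lemma exists_least_card (T : Type) (F : set (set T)) : F !=set0 ->
  exists2 B, F B & forall B', F B' -> B #<= B'.
Proof.
move=> [B0 FB0].
pose transversals (S : set (set T -> T)) :=
  (forall s, S s -> forall B, F B -> B (s B)) /\
  (forall s s', S s -> S s' -> forall B, F B -> s B = s' B -> s = s').
have [G GP totG|S [[SF injS] maxS]] := @Zorn_bigcup _ transversals.
  split=> [s [A GA As]|s s' [A GA As] [A' GA' As'] B FB].
    exact: (GP A GA).1.
  have [AA'|A'A] := totG _ _ GA GA'.
    by apply: (GP _ GA').2 FB => //; exact: AA'.
  by apply: (GP _ GA).2 FB => //; exact: A'A.
have [B FB BS] : exists2 B, F B & B `<=` [set s B | s in S].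
  apply: contrapT => noB.
  have /choice[t tP] : forall B, exists x, F B -> B x /\ ~ [set s B | s in S] x.
    move=> B; have [FB|nFB] := pselect (F B).
      have [x xP] : exists x, ~ (B x -> [set s B | s in S] x).
        by apply/existsNP => BS; apply: noB; exists B.
      by exists x => _; apply/not_implyP.
    have [s _] : exists s : set T -> T, True.
      have [x _] : exists x : T, True.
        apply: contrapT => noT; apply: noB; exists B0 => // x.
        by case: noT; exists x.
      by exists (fun=> x).
    by exists (s B).
  apply: (maxS (S `|` [set t])).
    split; first by move=> s; left.
    move=> /(_ t (or_intror erefl)) St.
    by have [_] := tP _ FB0; apply; exists t.
  split=> [s [Ss|->] B FB|s s' Ss Ss' B FB ss'].
  - exact: (SF _ Ss _ FB).
  - exact: (tP _ FB).1.
  have [_ tB] := tP _ FB.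
  move: Ss Ss' ss' => [Ss|->] [Ss'|->] // ss'.
  - exact: injS ss'.
  - by case: tB; exists s.
  - by case: tB; exists s'.
exists B => // B' FB'.
have /choice[g gP] : forall b, exists s, B b -> S s /\ s B = b.
  move=> b; have [/BS[s Ss sB]|nb] := pselect (B b); last first.
    by have [s] : exists s : set T -> T, True;
       [exists (fun=> b)|exists s].
  by exists s.
have inj_g : {in B &, injective (fun b => g b B')}.
  move=> b c /set_mem/gP[Sb bB] /set_mem/gP[Sc cB] bc.
  by rewrite -bB -cB (injS _ _ Sb Sc _ FB' bc).
rewrite -(card_le_eql (inj_card_eq inj_g)); apply: subset_card_le.
by move=> _ [b /gP[Sg _] <-]; exact: (SF _ Sg _ FB').
Qed.

(* So the default value set0 in the definition of weight is never taken. *)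
Lemma least_base_neq0 (Y : topologicalType) : least_base Y !=set0.
Proof.
have [|B bB minB] := @exists_least_card (set Y) basis; last by exists B.
exists open; split=> // x A; rewrite nbhsE => -[U [oU Ux] UA].
by exists U.
Qed.

(* A map f : X -> f[X] onto its image, itself a Tychonoff space. *)
Record map_onto (X : topologicalType) := MapOnto {
  map_image : topologicalType;
  map_fun :> X -> map_image;
  map_continuous : continuous map_fun;
  map_surjective : range map_fun = [set: map_image];
  map_tychonoff : tychonoff_space map_image }.

Definition skeletal (X Y : topologicalType) (f : X -> Y) : Prop :=
  forall U : set X, open U -> U !=set0 -> (closure (f @` U))° !=set0.

Definition homeomorphism (Y Z : topologicalType) (h : Z -> Y) : Prop :=
  continuous h /\
  exists k : Y -> Z, [/\ continuous k, cancel h k & cancel k h].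

Definition homeomorphic_maps (X Y Z : topologicalType)
    (f : X -> Y) (g : X -> Z) : Prop :=
  exists2 h : Z -> Y, homeomorphism h & f = h \o g.

Definition map_prec (X : topologicalType) (phi g : map_onto X) : Prop :=
  exists2 h : map_image phi -> map_image g,
    continuous h & (g : X -> _) = h \o phi.

Definition corestriction (X Y : Type) (f : X -> Y) : X -> set_type (range f) :=
  fun x => exist _ (f x) (mem_set (imageT f x)).

Definition diagonal_product (X : topologicalType) (J : Type)
    (phi : J -> map_onto X) : X -> prod_topology (fun a => map_image (phi a)) :=
  fun x a => phi a x.

(* The type of [corestriction (diagonal_product phi)] carries the subspace
   topology inherited from the product.  The universe of [map_onto X] is too
   large for [set (map_onto X)], hence the plain predicate Psi. *)
Definition multiplicative_lattice (X : topologicalType)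
    (Psi : map_onto X -> Prop) : Prop :=
  (forall f : map_onto X, exists phi : map_onto X,
     [/\ Psi phi, map_prec phi f &
         weight (map_image phi) #<= weight (map_image f)]) /\
  (forall (J : Type) (phi : J -> map_onto X), (forall a, Psi (phi a)) ->
     exists2 psi : map_onto X, Psi psi &
       homeomorphic_maps (corestriction (diagonal_product phi)) psi).

Definition skeletally_dugundji (X : topologicalType) : Prop :=
  exists2 Psi : map_onto X -> Prop, multiplicative_lattice Psi &
    forall phi, Psi phi -> skeletal phi.

Definition coZ (R : realType) (X : topologicalType) : set (set X) :=
  [set U | exists2 f : X -> R, continuous f & U = [set x | f x != 0]].
Arguments coZ : clear implicits.

Definition lattice_generated (X : Type) (A : set (set X)) : set (set X) :=
  smallest [set F | setI_closed F /\ setU_closed F] A.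

Definition Seq_property (X : Type) (P : set (set X)) : Prop :=
  forall W, P W -> exists U V : nat -> set X,
    [/\ (forall n, P (U n)), (forall n, P (V n)),
        (forall k, U k `<=` ~` V k /\ ~` V k `<=` U k.+1) &
        \bigcup_n U n = W].

Definition subset_c (R : realType) (X : topologicalType)
    (P : set (set X)) : Prop :=
  P `<=` coZ R X /\
  forall V, coZ R X V -> V !=set0 ->
    exists W, [/\ P W, W !=set0 &
      forall U, P U -> U !=set0 -> U `<=` W -> U `&` V !=set0].

Definition club (R : realType) (X : topologicalType)
    (C : set (set (set X))) : Prop :=
  [/\ forall A, C A -> A `<=` coZ R X /\ A #= [set: nat],
      forall A : nat -> set (set X), (forall n, C (A n)) ->
        (forall n, A n `<=` A n.+1) -> C (\bigcup_n A n) &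
      forall B : set (set X), B `<=` coZ R X -> countable B ->
        exists2 A, C A & B `<=` A].

Definition c_club (R : realType) (X : topologicalType)
    (C : set (set (set X))) : Prop :=
  club R C /\
  forall P, C P ->
    [/\ subset_c R P, Seq_property P, setU_closed P & setI_closed P].

Definition additive_c_club (R : realType) (X : topologicalType)
    (C : set (set (set X))) : Prop :=
  c_club R C /\
  forall A1 A2, C A1 -> C A2 -> C (lattice_generated (A1 `|` A2)).

(* Main.v *)
(* A countable lattice P of co-zero sets with the property Seq makes X, with
   the topology generated by P, a (not necessarily separated) normal space:
   every open set is an increasing union of closed sets, each contained in the
   interior of the next.  By Urysohn's lemma the continuous functions on this
   coarser space map X onto a Tychonoff space of which P is, up to preimages, a
   base, and that map is skeletal exactly when P satisfies the relation
   "subset_c coZ".  Given an additive c-club, call a lattice P local if each of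
   its nontrivial elements lies in a member of the club contained in P; the
   maps having a local lattice as base form a multiplicative lattice, because
   local lattices generate local lattices and because "subset_c coZ" reflects
   to members of the club by a closing-off argument.  Conversely, the countable
   Seq lattices of co-zero sets that are a base of some map of a multiplicative
   lattice of skeletal maps form an additive c-club. *)
Require Import Defs.
From HB Require Import structures.
From mathcomp Require Import all_boot all_order all_algebra finmap.
From mathcomp Require Import all_classical all_reals.
From mathcomp Require Import topology normedtype.
Import Order.TTheory GRing.Theory Num.Theory.
Import numFieldNormedType.Exports.

Set Implicit Arguments.
Unset Strict Implicit.
Unset Printing Implicit Defensive.

Local Open Scope classical_set_scope.
Local Open Scope card_scope.
Local Open Scope ring_scope.

(** * Infinite cardinals *)

(** Stating an injection as a relation spares the callers a default value in [U]; choice turns it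
    into a function once [A] is known to be nonempty. *)
Lemma card_le_rel T U (A : set T) (B : set U) (r : T -> U -> Prop) :
  (forall a, A a -> exists2 b, B b & r a b) ->
  (forall a a' b, A a -> A a' -> r a b -> r a' b -> a = a') -> A #<= B.
Proof.
move=> rAB rinj; have [->|/set0P[a0 Aa0]] := eqVneq A set0; first exact: card_ge0.
have [b0 _ _] := rAB _ Aa0.
have /choice[f fP] : forall a, exists b, A a -> B b /\ r a b.
  move=> a; have [/rAB[b Bb rab]|nAa] := pselect (A a); first by exists b.
  by exists b0.
have finj : {in A &, injective f}.
  move=> a a' /set_mem Aa /set_mem Aa' ff'.
  apply: (rinj _ _ (f a)) => //; first exact: (fP _ Aa).2.
  by rewrite ff'; exact: (fP _ Aa').2.
rewrite -(card_le_eql (inj_card_eq finj)); apply: subset_card_le.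
by move=> _ [a Aa <-]; exact: (fP _ Aa).1.
Qed.

Lemma card_le_relP T U (A : set T) (B : set U) : A #<= B ->
  exists r : T -> U -> Prop, (forall a, A a -> exists2 b, B b & r a b) /\
  (forall a a' b, A a -> A a' -> r a b -> r a' b -> a = a').
Proof.
move=> /card_leP[f].
exists (fun a b => exists a' : A, \val a' = a /\ \val (f a') = b); split.
  move=> a Aa; exists (\val (f (SigSub (mem_set Aa)))).
    exact: set_valP.
  by exists (SigSub (mem_set Aa)).
move=> _ _ b _ _ [a [<- fa]] [a' [<- fa']]; congr (\val _).
apply: (@inj _ _ _ f); rewrite ?inE //.
by apply: val_inj; rewrite fa fa'.
Qed.

Lemma card_le_funP T (A B : set T) : A #<= B ->
  exists2 f : T -> T, {in A &, injective f} & f @` A `<=` B.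
Proof.
move=> /card_le_relP[r [rB rinj]].
have /choice[f fP] : forall a, exists b, A a -> B b /\ r a b.
  move=> a; have [/rB[b Bb rab]|nAa] := pselect (A a); first by exists b.
  by exists a.
exists f => [a a' /set_mem Aa /set_mem Aa' ff'|_ [a Aa <-]]; last exact: (fP _ Aa).1.
apply: (rinj _ _ (f a)) => //; first exact: (fP _ Aa).2.
by rewrite ff'; exact: (fP _ Aa').2.
Qed.

Lemma card_le_setX T T' U U' (A : set T) (A' : set T') (B : set U) (B' : set U') :
  A #<= A' -> B #<= B' -> A `*` B #<= A' `*` B'.
Proof.
move=> /card_le_relP[r [rA rinj]] /card_le_relP[s [sB sinj]].
apply: (@card_le_rel _ _ _ _ (fun p q => r p.1 q.1 /\ s p.2 q.2)).
  move=> [a b] [/= /rA[a' A'a' raa'] /sB[b' B'b' sbb']].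
  by exists (a', b').
move=> [a b] [a' b'] [c d] [/= Aa Bb] [/= Aa' Bb'] [/= rac sbd] [ra'c sb'd].
by rewrite (rinj _ _ _ Aa Aa' rac ra'c) (sinj _ _ _ Bb Bb' sbd sb'd).
Qed.

(** Comparability holds because the two-element family made of [A] and [B] has a member of least
    cardinality. *)
Lemma card_le_total T (A B : set T) : A #<= B \/ B #<= A.
Proof.
have [|C [->|->] minC] := @exists_least_card T [set A; B].
- by exists A; left.
- by left; apply: minC; right.
- by right; apply: minC; left.
Qed.

Lemma infinite_set_neq T (A : set T) : infinite_set A ->
  exists u v, [/\ A u, A v & u <> v].
Proof.
move=> infA; have [u Au] := infinite_setN0 infA.
have [v [Av uv]] := infinite_setN0 (infinite_setD infA (finite_set1 u)).
by exists u, v; split => // ?; exact: uv.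
Qed.

(** Two distinct points [u] and [v] of [C] serve as tags: points of [A] are coded in the fibre over
    [u], the remaining points of [B] in the fibre over [v], so the union embeds into [C * C]. *)
Lemma card_leU T U (A B : set T) (C : set U) : infinite_set C ->
  C `*` C #<= C -> A #<= C -> B #<= C -> A `|` B #<= C.
Proof.
move=> /infinite_set_neq[u [v [Cu Cv uv]]] CC.
move=> /card_le_relP[r [rA rinj]] /card_le_relP[s [sB sinj]].
apply: (card_le_trans _ CC); apply: (@card_le_rel _ _ _ _ (fun x p =>
  A x /\ p.1 = u /\ r x p.2 \/ ~ A x /\ p.1 = v /\ s x p.2)).
  move=> x ABx; have [Ax|nAx] := pselect (A x).
    by have [b Cb rb] := rA _ Ax; exists (u, b) => //; left.
  have [//|/sB[b Cb sb]] := ABx.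
  by exists (v, b) => //; right.
move=> x x' [p q] ABx ABx' /= [[Ax [pu rx]]|[nAx [pv sx]]].
  move=> [[Ax' [_ rx']]|[_ [pv _]]]; first exact: (rinj _ _ q).
  by case: uv; rewrite -pu.
move=> [[_ [pu _]]|[nAx' [_ sx']]]; first by case: uv; rewrite -pu.
by case: ABx => // Bx; case: ABx' => // Bx'; exact: (sinj _ _ q).
Qed.

Lemma infinite_set_card_nat T (A : set T) : A #= [set: nat] -> infinite_set A.
Proof. by rewrite infiniteP card_eq_sym card_eq_le => /andP[]. Qed.

Lemma infinite_countable_subset T (A : set T) : infinite_set A ->
  exists N, [/\ N `<=` A, infinite_set N & N #= [set: nat]].
Proof.
move=> infA; have /card_le_relP[r [rA rinj]] := (infiniteP A).1 infA.
have /choice[f fP] : forall n, exists x, A x /\ r n x.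
  by move=> n; have [x] := rA n I; exists x.
have fE : range f #= [set: nat].
  apply: inj_card_eq => n m _ _ fnm.
  by apply: (rinj _ _ (f n)) => //; [exact: (fP n).2|rewrite fnm; exact: (fP m).2].
exists (range f); split=> //; first by move=> _ [n _ <-]; exact: (fP n).1.
exact: infinite_set_card_nat.
Qed.

Lemma countableU T (A B : set T) : countable A -> countable B ->
  countable (A `|` B).
Proof. by apply: card_leU; [exact: infinite_nat|exact: countableX]. Qed.

(* Zorn's lemma on graphs of injections D x D -> D with D a subset of K,
   starting from a countable D: if D is maximal and of smaller cardinality than
   K, then D embeds into K \ D and the injection extends. *)
Lemma card_setX_infinite T (K : set T) : infinite_set K -> K `*` K #<= K.
Proof.
move=> infK.
have [N [NK infN eN]] := infinite_countable_subset infK.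
have NN : N `*` N #<= N.
  have cN : countable N by rewrite (eq_countable eN).
  by rewrite (card_le_eqr eN); exact: countableX.
have /card_le_relP[r [rN rinj]] := NN.
(* The domain D is read off the diagonal pairs (a, a). [P G] then says that G relates D x D
   injectively and totally to D, with D inside K. *)
pose dom (G : set ((T * T) * T)) := [set a | exists c, G ((a, a), c)].
pose P (G : set ((T * T) * T)) := [/\
  forall a b c, G ((a, b), c) -> [/\ dom G a, dom G b & dom G c],
  dom G `<=` K,
  forall a b, dom G a -> dom G b -> exists c, G ((a, b), c) &
  forall p p' c, G (p, c) -> G (p', c) -> p = p'].
pose G0 := [set x : (T * T) * T | (N `*` N) x.1 /\ N x.2 /\ r x.1 x.2].
have domG0 : dom G0 = N.
  apply/seteqP; split=> [a [c [[Na _] _]] //|a Na].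
  by have [c Nc rc] := rN (a, a) (conj Na Na); exists c.
have PG0 : P G0.
  rewrite /P domG0; split=> // [a b c [[/= Na Nb] [Nc _]]//|a b Na Nb|].
    by have [c Nc rc] := rN (a, b) (conj Na Nb); exists c.
  by move=> p p' c [/= Np [_ rp]] [/= Np' [_ rp']]; exact: (rinj _ _ c).
(* Zorn is applied to what is added to [G0]: the empty chain is then admissible, and every domain
   that occurs contains the infinite set N. *)
have [|G [PG maxG]] := @Zorn_bigcup _ [set G | P (G0 `|` G)].
  move=> F FP totF /=.
  have mem x : (G0 `|` \bigcup_(X in F) X) x <->
      G0 x \/ exists2 X, F X & (G0 `|` X) x.
    split=> [[?|[X FX Xx]]|[?|[X FX [?|Xx]]]]; [by left|right|by left..|right].
      by exists X => //; right.
    by exists X.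
  have dm X : F X -> dom (G0 `|` X) `<=` dom (G0 `|` \bigcup_(X in F) X).
    by move=> FX a [c Xc]; exists c; apply/mem; right; exists X.
  have dm0 : dom G0 `<=` dom (G0 `|` \bigcup_(X in F) X).
    by move=> a [c Xc]; exists c; left.
  have memdom a : dom (G0 `|` \bigcup_(X in F) X) a ->
      dom G0 a \/ exists2 X, F X & dom (G0 `|` X) a.
    move=> [c /mem[?|[X FX Xc]]]; first by left; exists c.
    by right; exists X => //; exists c.
  have sub X Y : X `<=` Y -> G0 `|` X `<=` G0 `|` Y by exact: setUS.
  have subdom X Y : X `<=` Y -> dom X `<=` dom Y.
    by move=> XY a [c Xc]; exists c; exact: XY.
  split.
  - move=> a b c /mem[|[X FX Xabc]].
      by move=> /(let: And4 h _ _ _ := PG0 in h)[/dm0 ? /dm0 ? /dm0].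
    by have [/(_ _ _ _ Xabc)[/(dm _ FX) ? /(dm _ FX) ? /(dm _ FX)]] := FP _ FX.
  - move=> a /memdom[|[X FX]]; first by case: PG0 => _ + _ _; apply.
    by case: (FP _ FX) => _ + _ _; apply.
  - have two X : F X -> forall a b, dom (G0 `|` X) a -> dom (G0 `|` X) b ->
        exists c, (G0 `|` \bigcup_(X in F) X) (a, b, c).
      move=> FX a b Xa Xb; case: (FP _ FX) => _ _ /(_ _ _ Xa Xb)[c Xc] _.
      by exists c; apply/mem; right; exists X.
    have d0 X : dom G0 `<=` dom (G0 `|` X) by apply: subdom => ?; left.
    move=> a b /memdom[a0|[X FX Xa]] /memdom[b0|[Y FY Yb]].
    + by case: PG0 => _ _ /(_ _ _ a0 b0)[c Gc] _; exists c; left.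
    + by apply: (two Y) => //; exact: d0.
    + by apply: (two X) => //; exact: d0.
    + have [XY|YX] := totF _ _ FX FY.
        by apply: (two Y) => //; apply: subdom Xa; exact: sub.
      by apply: (two X) => //; apply: subdom Yb; exact: sub.
  - move=> p p' c /mem[p0|[X FX Xp]] /mem[p'0|[Y FY Yp']].
    + by case: PG0 => _ _ _ h; exact: (h _ _ c).
    + by case: (FP _ FY) => _ _ _ h; apply: (h _ _ c) => //; left.
    + by case: (FP _ FX) => _ _ _ h; apply: (h _ _ c) => //; left.
    + have [XY|YX] := totF _ _ FX FY.
        by case: (FP _ FY) => _ _ _ h; apply: (h _ _ c) => //; exact: sub Xp.
      by case: (FP _ FX) => _ _ _ h; apply: (h _ _ c) => //; exact: sub Yp'.
have [H1 H2 H3 H4] := PG; set H := G0 `|` G in H1 H2 H3 H4 PG.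
have infD : infinite_set (dom H).
  by apply: sub_infinite_set infN; rewrite -domG0 => a [c ?]; exists c; left.
have DD : dom H `*` dom H #<= dom H.
  apply: (@card_le_rel _ _ _ _ (fun p c => H (p, c))) => [[a b] [/= Da Db]|].
    by have [c Hc] := H3 _ _ Da Db; exists c => //; have [] := H1 _ _ _ Hc.
  by move=> p p' c _ _; exact: H4.
have [KD|/card_le_funP] :=
    card_le_total (K `\` dom H) (dom H).
  have KleD : K #<= dom H.
    apply: (card_le_trans _ (card_leU infD DD (card_lexx (dom H)) KD)).
    by apply: subset_card_le => x Kx; have [] := pselect (dom H x); [left|right].
  apply: (card_le_trans (card_le_setX KleD KleD)).
  exact/(card_le_trans DD)/subset_card_le.
move=> [f finj fK]; exfalso; pose D' := f @` dom H; pose E := dom H `|` D'.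
(* D' is a copy of D disjoint from it. The pairs of E x E outside D x D are at most |D| = |D'| many,
   so they can take values in D', away from all values of H. *)
have ED : E #<= dom H by apply: card_leU => //; exact: card_image_le.
have : (E `*` E) `\` (dom H `*` dom H) #<= D'.
  rewrite (card_le_eqr (inj_card_eq finj)).
  apply: (card_le_trans _ DD); apply: (card_le_trans _ (card_le_setX ED ED)).
  exact: subset_card_le.
move=> /card_le_relP[s [sD sinj]].
pose G' := [set x : (T * T) * T |
  ((E `*` E) `\` (dom H `*` dom H)) x.1 /\ D' x.2 /\ s x.1 x.2].
have D'D a : D' a -> ~ dom H a by move=> /fK[].
have G'diag a : D' a -> exists c, G' ((a, a), c).
  move=> D'a; have aa : ((E `*` E) `\` (dom H `*` dom H)) (a, a).
    by split=> [|[/= Da _]]; [split; right|exact: (D'D a)].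
  by have [c D'c sc] := sD _ aa; exists c.
have domHG : dom (G0 `|` (G `|` G')) = E.
  rewrite setUA; apply/seteqP; split=> [a [c [Hc|[[[/= Ea _] _] _]]]|a [[c Hc]|]].
  - by left; exists c.
  - exact: Ea.
  - by exists c; left.
  - by move=> /G'diag[c G'c]; exists c; right.
apply: (maxG (G `|` G')).
  split; first by move=> x; left.
  move=> sub; have [a Da] := infinite_setN0 infD.
  have [|c G'c] := G'diag (f a); first by exists a.
  have /sub Gc : (G `|` G') ((f a, f a), c) by right.
  by apply: (D'D (f a)); [exists a|exists c; right].
rewrite /= /P domHG setUA; split.
- move=> a b c [/H1[? ? ?]|[[[/= Ea Eb] _] [D'c _]]]; first by split; left.
  by split => //; right.
- by move=> a [/H2//|/fK[]].
- move=> a b Ea Eb.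
  have [[Da Db]|nD] := pselect (dom H a /\ dom H b).
    by have [c Hc] := H3 _ _ Da Db; exists c; left.
  have ab : ((E `*` E) `\` (dom H `*` dom H)) (a, b) by [].
  by have [c D'c sc] := sD _ ab; exists c; right.
- move=> p p' c [Hp|[pE [D'c sp]]] [Hp'|[p'E [D'c' sp']]].
  + exact: H4 Hp Hp'.
  + by case: p Hp => a b /H1[_ _ /(D'D _ D'c')].
  + by case: p' Hp' => a b /H1[_ _ /(D'D _ D'c)].
  + exact: sinj sp sp'.
Qed.

(** A point is coded by a chosen index of a member containing it, together with its code inside that
    member; this embeds the union into [K * K]. *)
Lemma card_le_bigcup I T U (D : set I) (F : I -> set T) (K : set U) :
  infinite_set K -> D #<= K -> (forall i, D i -> F i #<= K) ->
  \bigcup_(i in D) F i #<= K.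
Proof.
move=> infK /card_le_relP[r [rK rinj]] FK.
apply: (card_le_trans _ (card_setX_infinite infK)).
have [T0|/set0P[x0]] := eqVneq (\bigcup_(i in D) F i) set0.
  by rewrite T0; exact: card_ge0.
move=> [i0 _ _].
have /choice[idx idxP] :
    forall x, exists i, (\bigcup_(i in D) F i) x -> D i /\ F i x.
  move=> x; have [[i Di Fix]|nx] := pselect ((\bigcup_(i in D) F i) x).
    by exists i.
  by exists i0.
have /choice[s sP] : forall i, exists s : T -> U -> Prop, D i ->
    (forall x, F i x -> exists2 b, K b & s x b) /\
    (forall x x' b, F i x -> F i x' -> s x b -> s x' b -> x = x').
  move=> i; have [/FK/card_le_relP[s sP]|nDi] := pselect (D i).
    by exists s.
  by exists (fun _ _ => True).
apply: (@card_le_rel _ _ _ _ (fun x p => r (idx x) p.1 /\ s (idx x) x p.2)).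
  move=> x /idxP[Di Fx]; have [a Ka ra] := rK _ Di.
  by have [b Kb sb] := (sP _ Di).1 _ Fx; exists (a, b).
move=> x x' [a b] /idxP[Di Fx] /idxP[Di' Fx'] /= [ra sb] [ra' sb'].
have ii' := rinj _ _ _ Di Di' ra ra'.
by apply: ((sP _ Di).2 _ _ b) => //; rewrite ii'.
Qed.

(** A countable family of binary operations; a unary operation is encoded by ignoring the second
    argument. *)
Definition ops_closed T (op : nat -> T -> T -> T) : set (set T) :=
  [set F | forall n a b, F a -> F b -> F (op n a b)].

Lemma ops_closed_smallest T (op : nat -> T -> T -> T) (E : set T) :
  ops_closed op (smallest (ops_closed op) E).
Proof.
by move=> n a b Ea Eb F [clF EF]; apply: (clF); [apply: Ea|apply: Eb].
Qed.

(** The closure is exhausted by countably many stages, each adding the values of all operations on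
    the previous one, and no stage exceeds K because [K * K] does not. *)
Lemma card_smallest_ops T U (op : nat -> T -> T -> T) (E : set T) (K : set U) :
  infinite_set K -> E #<= K -> smallest (ops_closed op) E #<= K.
Proof.
move=> infK EK.
pose step F := F `|` \bigcup_n [set op n x.1 x.2 | x in F `*` F].
pose It n := iter n step E.
have leIt m n : (m <= n)%N -> It m `<=` It n.
  move=> /subnK<-; elim: (n - m)%N => [//|k IH].
  by rewrite addSn => x /IH; left.
have natK : [set: nat] #<= K by exact/infiniteP.
have ItK n : It n #<= K.
  elim: n => [//|n IH]; apply: card_leU => //; first exact: card_setX_infinite.
  apply: card_le_bigcup => // m _.
  apply: (card_le_trans (card_image_le _ _)).
  apply: (card_le_trans (card_le_setX IH IH)); exact: card_setX_infinite.
apply: (@card_le_trans _ _ _ (\bigcup_n It n)); last exact: card_le_bigcup.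
apply: subset_card_le; apply: smallest_sub; last by move=> x Ex; exists 0.
move=> n a b [i _ Ia] [j _ Ib]; exists (maxn i j).+1 => //.
right; exists n => //; exists (a, b) => //; split=> /=.
  by apply: leIt Ia; rewrite leq_maxl.
by apply: leIt Ib; rewrite leq_maxr.
Qed.

Lemma countable_enum T (A : set T) : A !=set0 -> countable A ->
  exists e : nat -> T, range e = A.
Proof.
move=> [a Aa] /pfcard_geP[A0|[e]]; first by move: Aa; rewrite A0.
exists e; apply/seteqP; split=> [_ [n _ <-]|x Ax]; first exact: funS.
by have [n _ <-] := @surj _ _ _ _ e x Ax; exists n.
Qed.

(** * Lattices of sets with the property Seq *)

Definition lattice_of_sets (X : Type) (P : set (set X)) :=
  [/\ P set0, P setT, setI_closed P & setU_closed P].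

Lemma Seq_increasing (X : Type) (U V : nat -> set X) :
  (forall k, U k `<=` ~` V k /\ ~` V k `<=` U k.+1) ->
  forall n m, (n <= m)%N -> U n `<=` U m.
Proof.
move=> UV n m /subnK <-; elim: (m - n)%N => [//|k IH].
by rewrite addSn => x /IH/(UV _).1/(UV _).2.
Qed.

Lemma Seq_decreasing (X : Type) (U V : nat -> set X) :
  (forall k, U k `<=` ~` V k /\ ~` V k `<=` U k.+1) ->
  forall n m, (n <= m)%N -> V m `<=` V n.
Proof.
move=> UV n m /subnK <-; elim: (m - n)%N => [//|k IH].
rewrite addSn => x Vx; apply: IH; apply: contrapT => /(UV _).2/(UV _).1.
exact.
Qed.

(** * Generated lattices *)

Section lattice_generated.
Variables (X : Type) (E : set (set X)).

Lemma lattice_generated_setI : setI_closed (lattice_generated E).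
Proof.
by move=> A B hA hB F [[FI FU] EF]; apply: (FI); [apply: hA|apply: hB].
Qed.

Lemma lattice_generated_setU : setU_closed (lattice_generated E).
Proof.
by move=> A B hA hB F [[FI FU] EF]; apply: (FU); [apply: hA|apply: hB].
Qed.

Lemma lattice_generated_ind (Q : set (set X)) :
  (forall U, E U -> Q U) -> setI_closed Q -> setU_closed Q ->
  lattice_generated E `<=` Q.
Proof. by move=> EQ QI QU; apply: smallest_sub. Qed.

Lemma sub_lattice_generated : E `<=` lattice_generated E.
Proof. exact: sub_gen_smallest. Qed.

Lemma lattice_of_sets_generated : E set0 -> E setT ->
  lattice_of_sets (lattice_generated E).
Proof.
move=> E0 ET; split; [exact: sub_lattice_generated..| |].
  exact: lattice_generated_setI.
exact: lattice_generated_setU.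
Qed.

Lemma card_lattice_generated U (K : set U) : infinite_set K -> E #<= K ->
  lattice_generated E #<= K.
Proof.
move=> infK EK.
pose op (n : nat) (A B : set X) := if n is 0%N then A `&` B else A `|` B.
apply: (card_le_trans _ (card_smallest_ops op infK EK)); apply: subset_card_le.
have opE := @ops_closed_smallest _ op E.
apply: lattice_generated_ind => [A EA|A B hA hB|A B hA hB].
- exact: sub_gen_smallest.
- exact: (opE 0%N A B).
- exact: (opE 1%N A B).
Qed.

(** Seq sequences combine termwise: for an intersection, intersect the U's and unite the V's, and
    dually for a union. For intersections the monotonicity of the U's brings two indices to a common
    one. *)
Lemma Seq_lattice_generated : Seq_property E -> Seq_property (lattice_generated E).
Proof.
move=> SeqE; pose P := lattice_generated E.
apply: (@lattice_generated_ind (fun W => exists U V : nat -> set X,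
    [/\ forall n, P (U n), forall n, P (V n),
        forall k, U k `<=` ~` V k /\ ~` V k `<=` U k.+1 &
        \bigcup_n U n = W])) => [W /SeqE[U [V [EU EV UV UW]]]|W W'|W W'].
- by exists U, V; split=> // n; exact: sub_lattice_generated.
- move=> [U [V [PU PV UV UW]]] [U' [V' [PU' PV' UV' UW']]].
  exists (fun n => U n `&` U' n), (fun n => V n `|` V' n); split.
  + by move=> n; apply: lattice_generated_setI; [exact: PU|exact: PU'].
  + by move=> n; apply: lattice_generated_setU; [exact: PV|exact: PV'].
  + move=> k; rewrite setCU; split; apply: setISS;
      [exact: (UV k).1|exact: (UV' k).1|exact: (UV k).2|exact: (UV' k).2].
  + rewrite -UW -UW'; apply/seteqP; split=> [x [n _ [Ux U'x]]|].
      by split; exists n.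
    move=> x [[n _ Ux] [m _ U'x]]; exists (maxn n m) => //; split.
      by apply: (Seq_increasing UV) Ux; rewrite leq_maxl.
    by apply: (Seq_increasing UV') U'x; rewrite leq_maxr.
- move=> [U [V [PU PV UV UW]]] [U' [V' [PU' PV' UV' UW']]].
  exists (fun n => U n `|` U' n), (fun n => V n `&` V' n); split.
  + by move=> n; apply: lattice_generated_setU; [exact: PU|exact: PU'].
  + by move=> n; apply: lattice_generated_setI; [exact: PV|exact: PV'].
  + move=> k; rewrite setCI; split; apply: setUSS;
      [exact: (UV k).1|exact: (UV' k).1|exact: (UV k).2|exact: (UV' k).2].
  + by rewrite -UW -UW' bigcupU.
Qed.

End lattice_generated.

Lemma lattice_of_sets_generated01 (X : Type) (E : set (set X)) :
  lattice_of_sets (lattice_generated ([set set0; setT] `|` E)).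
Proof. by apply: lattice_of_sets_generated; left; [left|right]. Qed.

(** The Seq sequences of any one member produce the bounds: U_0 and V_0 are disjoint, and U_1
    together with V_0 covers X. *)
Lemma Seq_lattice_of_sets (X : Type) (P : set (set X)) : P !=set0 ->
  Seq_property P -> setU_closed P -> setI_closed P -> lattice_of_sets P.
Proof.
move=> [W PW] SeqP PU PI; have [U [V [PUn PVn UV _]]] := SeqP _ PW.
split=> //.
  have -> : set0 = U 0%N `&` V 0%N; last exact: PI.
  by apply/esym; rewrite -subset0 => x [/(UV 0%N).1].
have -> : setT = U 1%N `|` V 0%N; last exact: PU.
apply/esym/seteqP; split=> // x _.
by have [|/(UV 0%N).2] := pselect (V 0%N x); [right|left].
Qed.

(** A closing-off argument: fix Seq sequences for every member of Q, and close S under taking their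
    terms and under the lattice operations. *)
Lemma Seq_closure (X : Type) (S Q : set (set X)) :
  lattice_of_sets Q -> Seq_property Q -> countable S -> S `<=` Q ->
  exists T, [/\ S `<=` T, T `<=` Q, countable T, lattice_of_sets T & Seq_property T].
Proof.
move=> [Q0 QT QI QU] SeqQ cS SQ.
have /choice[u /choice[v uv]] : forall W, exists U V : nat -> set X, Q W ->
    [/\ forall n, Q (U n), forall n, Q (V n),
     forall k, U k `<=` ~` V k /\ ~` V k `<=` U k.+1 & \bigcup_n U n = W].
  move=> W; have [/SeqQ[U [V UV]]|nQW] := pselect (Q W); first by exists U, V.
  by exists (fun=> set0), (fun=> set0).
(* Operations 0 and 1 are the lattice operations; operation 2m+3 returns the m-th U of [A], and
   operation 2m+2 its m-th V. *)
pose op n (A B : set X) := match n with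
  | 0%N => A `&` B | 1%N => A `|` B
  | n.+2 => if odd n then u A n./2 else v A n./2 end.
pose T := smallest (ops_closed op) (S `|` [set set0]).
have opT : ops_closed op T := @ops_closed_smallest _ op _.
have ST : S `<=` T by move=> s Ss; apply: sub_gen_smallest; left.
have uT W n : T W -> T (u W n).
  move=> TW; have := opT n.*2.+3 W W TW TW.
  by rewrite /op /= odd_double /= uphalf_double.
have vT W n : T W -> T (v W n).
  move=> TW; have := opT n.*2.+2 W W TW TW.
  by rewrite /op odd_double doubleK.
have TQ : T `<=` Q.
  apply: smallest_sub => [n A B QA QB|U [/SQ //|->] //].
  case: n => [|[|n]] /=; [exact: QI|exact: QU|].
  by have [uQ vQ _ _] := uv _ QA; case: ifP.
have SeqT : Seq_property T.
  move=> W TW; exists (u W), (v W).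
  by have [_ _ uvW uW] := uv _ (TQ _ TW); split=> // n; [exact: uT|exact: vT].
exists T; split=> //.
  apply: card_smallest_ops; first exact: infinite_nat.
  by rewrite -/(countable _); apply: countableU => //; exact: countable1.
apply: Seq_lattice_of_sets => //.
- by exists set0; apply: sub_gen_smallest; right.
- exact: (opT 1%N).
- exact: (opT 0%N).
Qed.

(** * Co-zero sets *)

Section cozero.
Variable R : realType.

Lemma coZ0 (X : topologicalType) : coZ R X set0.
Proof.
exists (fun=> 0) => [x|]; first exact: cvg_cst.
by apply/seteqP; split=> // x /=; rewrite eqxx.
Qed.

Lemma coZT (X : topologicalType) : coZ R X setT.
Proof.
exists (fun=> 1) => [x|]; first exact: cvg_cst.
by apply/seteqP; split=> // x /= _; rewrite oner_neq0.
Qed.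

Lemma coZ_open (X : topologicalType) U : coZ R X U -> open U.
Proof.
move=> [f cf ->]; rewrite (_ : mkset _ = f @^-1` (~` [set 0])).
  apply: open_comp => [x _|]; first exact: cf.
  apply: closed_openC; exact: closed_eq.
by apply/seteqP; split=> x /= /eqP.
Qed.

Lemma coZ_preimage (X Y : topologicalType) (f : X -> Y) U :
  continuous f -> coZ R Y U -> coZ R X (f @^-1` U).
Proof.
move=> cf [g cg ->]; exists (g \o f) => // x.
by apply: continuous_comp; [exact: cf|exact: cg].
Qed.

Lemma coZ_gt0 (X : topologicalType) (f : X -> R) :
  continuous f -> coZ R X [set x | 0 < f x].
Proof.
move=> cf; exists (fun x => Num.max (f x) 0).
  move=> x; apply: (@continuous_max R X f (fun=> 0)); [exact: cf|exact: cvg_cst].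
apply/seteqP; split=> x /=; case: (ltP 0 (f x)) => // fx.
  by rewrite gt_eqF.
by rewrite eqxx.
Qed.

Lemma coZ_setI (X : topologicalType) : setI_closed (coZ R X).
Proof.
move=> _ _ [f cf ->] [g cg ->]; exists (fun x => f x * g x).
  by move=> x; apply: cvgM; [exact: cf|exact: cg].
by apply/seteqP; split=> x /=; rewrite mulf_eq0 negb_or => /andP.
Qed.

Lemma coZ_setU (X : topologicalType) : setU_closed (coZ R X).
Proof.
move=> _ _ [f cf ->] [g cg ->]; exists (fun x => `|f x| + `|g x|).
  move=> x; apply: cvgD; apply: continuous_comp;
    [exact: cf|exact: norm_continuous|exact: cg|exact: norm_continuous].
apply/seteqP; split=> x /=; rewrite paddr_eq0 ?normr_ge0// !normr_eq0 negb_and.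
  by move=> [->|->]; rewrite ?orbT.
by move=> /orP.
Qed.

(** Level sets: U_n is |f| > 1/(n+1) and V_n is |f| < 1/(n+1), both written as positivity sets of
    continuous functions. The complement of V_k lies in U_(k+1) since 1/(k+2) < 1/(k+1). *)
Lemma Seq_coZ (X : topologicalType) : Seq_property (coZ R X).
Proof.
move=> _ [f cf ->].
pose e n : R := n.+1%:R^-1.
have cnf : continuous (fun x => `|f x|).
  by move=> x; apply: continuous_comp; [exact: cf|exact: norm_continuous].
exists (fun n => [set x | 0 < `|f x| - e n]), (fun n => [set x | 0 < e n - `|f x|]).
split.
- move=> n; apply: coZ_gt0 => x.
  by apply: cvgB; [exact: cnf|exact: cvg_cst].
- move=> n; apply: coZ_gt0 => x.
  by apply: cvgB; [exact: cvg_cst|exact: cnf].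
- move=> n; split=> x /=; rewrite !subr_gt0.
    by move=> /ltW; rewrite leNgt => /negP.
  move=> /negP; rewrite -leNgt; apply: lt_le_trans.
  by rewrite ltf_pV2 ?posrE ?ltr0n// ltr_nat.
- apply/seteqP; split=> x /=; rewrite -?normr_gt0.
    by move=> [n _ /=]; rewrite subr_gt0; apply: le_lt_trans; rewrite invr_ge0.
  move=> fx0; have [n nfx] := ltr_add_invr fx0.
  by exists n => //=; rewrite subr_gt0; move: nfx; rewrite add0r.
Qed.

Lemma coZ_separation (X : topologicalType) (x : X) (O : set X) :
  completely_regular_space X -> open O -> O x ->
  exists f : X -> R, [/\ continuous f, f x = 1 & forall y, ~ O y -> f y = 0].
Proof.
move=> crX oO Ox.
have /(@uniform_separatorP _ R)[f [cf _ f0 f1]] :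
    uniform_separator [set x] (~` O).
  by apply: crX; [exact: open_closedC|exact].
have fx : f x = 0 by apply: f0; exists x.
exists (fun y => 1 - f y); split.
- by move=> y; apply: cvgB; [exact: cvg_cst|exact: cf].
- by rewrite fx subr0.
- by move=> y nOy; rewrite (f1 (f y)) ?subrr//; exists y.
Qed.

Lemma coZ_nbhs (X : topologicalType) (x : X) (O : set X) :
  completely_regular_space X -> open O -> O x ->
  exists U, [/\ coZ R X U, U x & U `<=` O].
Proof.
move=> crX oO Ox; have [f [cf fx f0]] := coZ_separation crX oO Ox.
exists [set y | f y != 0]; split.
- by exists f.
- by rewrite /= fx oner_neq0.
- by move=> y; apply: contra_neqP => /f0.
Qed.

Lemma coZ_completely_regular (X : topologicalType) :
  (forall (x : X) O, open O -> O x -> exists U, [/\ coZ R X U, U x & U `<=` O]) ->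
  completely_regular_space X.
Proof.
move=> coZX x B clB nBx.
have [_ [[f cf ->] fx fB]] := coZX x (~` B) (closed_openC clB) nBx.
apply/(@uniform_separatorP _ R).
have f0 : `|f x| != 0 by rewrite normr_eq0.
(* Zero at [x], one wherever [f] vanishes, in particular on [B], and clipped to the unit
   interval. *)
exists (fun y => Num.max 0 (1 - `|f y| / `|f x|)); split.
- move=> y; apply: (@continuous_max R X (fun=> 0) (fun y => 1 - `|f y| / `|f x|)).
    exact: cvg_cst.
  apply: cvgB; first exact: cvg_cst.
  apply: cvgM; last exact: cvg_cst.
  by apply: continuous_comp; [exact: cf|exact: norm_continuous].
- move=> _ [y _ <-] /=; rewrite in_itv /=.
  by rewrite le_max lexx /= ge_max ler01 /= gerBl divr_ge0.
- by move=> _ [y -> <-]; rewrite divff // subrr maxxx.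
- move=> _ [y By <-].
  have -> : f y = 0 by apply: contrapT => /eqP fy; exact: (fB y).
  by rewrite normr0 mul0r subr0; apply/max_idPr.
Qed.

End cozero.

Lemma tychonoff_realType (R : realType) : tychonoff_space R.
Proof.
split; first exact: uniform_completely_regular.
apply: hausdorff_accessible; exact: Rhausdorff.
Qed.

Lemma second_countable_realType (R : realType) :
  exists2 B : set (set R), countable B & basis B.
Proof.
exists [set [set x : R | ratr pq.1 < x < ratr pq.2] | pq in [set: rat * rat]].
  by apply: (sub_countable (card_image_le _ _)); exact: countableP.
split=> [_ [[p q] _ <-] /=|x A].
  have := @interval_open R (BRight (ratr p)) (BLeft (ratr q)) isT isT.
  by rewrite set_itvoo.
move=> /nbhs_ballP[e /= e0 eA].
have [p pI] := @rat_in_itvoo R (x - e) x ltac:(by rewrite ltrBlDr ltrDl).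
have [q qI] := @rat_in_itvoo R x (x + e) ltac:(by rewrite ltrDl).
move: pI qI; rewrite !in_itv /= => /andP[xp px] /andP[xq qx].
exists [set x : R | ratr p < x < ratr q].
  by split; [exists (p, q)|rewrite /= px xq].
move=> y /= /andP[py yq]; apply: eA; rewrite /ball /= ltr_norml.
rewrite ltrNl opprB ltrBlDl (lt_trans yq qx) /= ltrBlDl -ltrBlDr.
exact: lt_trans xp py.
Qed.

(** With finitely many co-zero sets, each singleton would be the finite intersection of the co-zero
    sets around its point, hence co-zero, and X would inject into a finite family. *)
Lemma infinite_coZ (R : realType) (X : topologicalType) :
  tychonoff_space X -> infinite_set [set: X] -> infinite_set (coZ R X).
Proof.
move=> [crX t1X] infX finZ; apply: infX.
have coZ1 x : coZ R X [set x].
  have finx : finite_set [set U | coZ R X U /\ U x].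
    by apply: sub_finite_set finZ => U [].
  have -> : [set x] = \bigcap_(U in [set U | coZ R X U /\ U x]) U.
    apply/seteqP; split=> [_ -> U [] //|y xy]; apply: contrapT => /eqP nyx.
    rewrite eq_sym in nyx; have [A [oA xA yA]] := t1X _ _ nyx.
    rewrite !inE in xA yA; have [U [coZU Ux UA]] := coZ_nbhs R crX oA xA.
    by apply/yA/UA; exact: (xy U (conj coZU Ux)).
  rewrite -bigsetI_fset_set // big_seq; apply: big_ind => [||U].
  - exact: coZT.
  - exact: coZ_setI.
  - by rewrite in_fset_set // inE => -[].
apply: (@card_le_finite _ _ _ (coZ R X)) => //.
apply: (@card_le_rel _ _ _ _ (fun x U => U = [set x])) => [x _|x y U _ _ -> xy].
  by exists [set x].
by have : [set x] x by []; rewrite xy.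
Qed.

(** * Topologies generated by lattices *)

Section retop.

(** An alias of X with P as a subbase, so that one and the same function can be called continuous
    for the original topology or for the one generated by P. *)
Definition retop (X : choiceType) (P : set (set X)) : Type := X.

HB.instance Definition _ (X : choiceType) (P : set (set X)) :=
  Choice.on (retop P).
HB.instance Definition _ (X : choiceType) (P : set (set X)) :=
  isSubBaseTopological.Build (retop P) P id.

Variables (X : choiceType) (P : set (set X)).

Lemma retop_open U : P U -> open (U : set (retop P)).
Proof.
move=> PU; exists [set U]; last by rewrite bigcup_set1.
move=> _ ->; exists [fset U]%fset; last by rewrite set_fset1 bigcap_set1.
by move=> V /= /fset1P ->; rewrite inE.
Qed.

Hypotheses (PT : P setT) (PI : setI_closed P).

Lemma nbhs_retopP (x : retop P) A :
  nbhs x A <-> exists U, [/\ P U, U x & U `<=` A].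
Proof.
split=> [|[U [PU Ux UA]]]; last first.
  by rewrite nbhsE; exists U => //; split => //; exact: retop_open.
rewrite nbhsE => -[_ [[D DP <-] [B DB Bx]] DA].
exists B; split=> //; last by move=> y By; apply: DA; exists B.
have [F FP <-] := DP _ DB.
rewrite bigcap_fset big_seq; apply: big_ind => // V VF.
by have := FP _ VF; rewrite inE.
Qed.

Lemma open_retopP (O : set (retop P)) :
  open O <-> forall x, O x -> exists U, [/\ P U, U x & U `<=` O].
Proof.
rewrite openE; split=> [oO x /oO/nbhs_retopP //|oO x /oO ?].
exact/nbhs_retopP.
Qed.

Lemma continuous_retopP (Y : topologicalType) (f : X -> Y) :
  continuous (f : retop P -> Y) <-> forall (O : set Y) x, open O -> O (f x) ->
    exists U, [/\ P U, U x & U `<=` f @^-1` O].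
Proof.
split=> [/continuousP cf O x oO Ofx|cf].
  by have /open_retopP/(_ x Ofx) := cf _ oO.
by apply/continuousP => O oO; apply/open_retopP => x Ofx; exact: cf.
Qed.

End retop.

Lemma retop_subset_continuous (X : choiceType) (Y : topologicalType)
    (P Q : set (set X)) (f : X -> Y) :
  lattice_of_sets P -> lattice_of_sets Q -> P `<=` Q ->
  continuous (f : retop P -> Y) -> continuous (f : retop Q -> Y).
Proof.
move=> [_ PT PI _] [_ QT QI _] PQ /(continuous_retopP PT PI) cf.
apply/(continuous_retopP QT QI) => O x oO Ofx.
by have [U [PU Ux UO]] := cf _ _ oO Ofx; exists U; split=> //; exact: PQ.
Qed.

Lemma retop_open_continuous (X Y : topologicalType) (P : set (set X)) (f : X -> Y) :
  lattice_of_sets P -> P `<=` open -> continuous (f : retop P -> Y) ->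
  continuous f.
Proof.
move=> [_ PT PI _] Po /(continuous_retopP PT PI) cf.
apply/continuousP => O oO; rewrite openE => x Ofx.
have [U [PU Ux UO]] := cf _ _ oO Ofx.
by rewrite /interior nbhsE; exists U => //; split=> //; exact: Po.
Qed.

(** * Diagonal products as subspaces of the product *)

Section diagonal.
Variables (X : choiceType) (J : Type) (Y : J -> topologicalType).
Variable f : forall a, X -> Y a.

(** Taken for bare functions, so that continuity from [retop P] can be discussed too; for bundled
    maps it unfolds to [corestriction (diagonal_product phi)]. *)
Definition diagonal_map :
    X -> set_type (range ((fun x a => f a x) : X -> prod_topology Y)) :=
  corestriction ((fun x a => f a x) : X -> prod_topology Y).

Local Notation D := (set_type (range ((fun x a => f a x) : X -> prod_topology Y))).

Lemma diagonal_map_surjective : range diagonal_map = [set: D].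
Proof.
apply/seteqP; split=> // z _; have [x _ xz] := set_valP z.
by exists x => //; apply: val_inj.
Qed.

Lemma diagonal_coord_continuous a : continuous (fun z : D => set_val z a).
Proof.
move=> z; apply: (@continuous_comp _ _ _ (set_val : D -> prod_topology Y)
  (fun g : prod_topology Y => g a)).
  exact: initial_continuous.
exact: (@proj_continuous {classic J} Y a).
Qed.

Lemma continuous_diagonal (Z : topologicalType) (g : Z -> D) :
  (forall a, continuous (fun z => set_val (g z) a)) -> continuous g.
Proof.
move=> cg; apply: continuous_comp_initial => z.
apply/cvg_sup => a.
exact: (@continuous_comp_initial _ _ _ (fun h : (forall a, Y a) => h a)
  (set_val \o g) (cg a) z).
Qed.

Variable R : realType.

(** Complete regularity follows once co-zero sets form a base, that is, once the identity from
    [retop (coZ R D)] is continuous, and this is checked coordinatewise. Distinct points are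
    separated at a coordinate where they differ. *)
Lemma diagonal_tychonoff : (forall a, tychonoff_space (Y a)) -> tychonoff_space D.
Proof.
move=> tY; split.
  apply: (@coZ_completely_regular R) => x O oO Ox.
  have PT := coZT R D; have PI := @coZ_setI R D.
  have /(continuous_retopP PT PI) : continuous (id : retop (coZ R D) -> D).
    apply: (@continuous_diagonal (retop (coZ R D)) id) => a.
    apply/(continuous_retopP PT PI) => G z oG Gz.
    have [U [zU Uz UG]] := @coZ_nbhs R _ _ _ (tY a).1 oG Gz.
    exists ((fun z : D => set_val z a) @^-1` U); split=> //.
      by apply: coZ_preimage => //; exact: diagonal_coord_continuous.
    by move=> y /UG.
  by move=> /(_ _ _ oO Ox).
move=> z z' zz'.
have [a za] : exists a, set_val z a != set_val z' a.
  apply: contrapT => nex; move/eqP: zz'; apply; apply: val_inj.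
  apply: functional_extensionality_dep => a.
  by apply: contrapT => /eqP za; apply: nex; exists a.
have [A [oA zA z'A]] := (tY a).2 _ _ za.
exists ((fun z : D => set_val z a) @^-1` A); split.
- by apply: open_comp => // ? _; exact: diagonal_coord_continuous.
- by move: zA; rewrite !inE.
- by move: z'A; rewrite !inE.
Qed.

End diagonal.

(** The argument for regular Lindelof spaces. Every V_n contains A and every V'_n contains B, while
    the U'_n cover A and the U_n cover B; the sets U'_n & V_n and U_m & V'_m are disjoint because
    both V sequences decrease. *)
Lemma Seq_open_normal (R : realType) (T : topologicalType) :
  Seq_property (@open T) -> normal_space T.
Proof.
move=> SeqT; apply/(@normal_openP R) => A B cA cB AB0.
have [U [V [oU oV UV UA]]] := SeqT _ (closed_openC cA).
have [U' [V' [oU' oV' UV' UB]]] := SeqT _ (closed_openC cB).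
exists (\bigcup_n (U' n `&` V n)), (\bigcup_n (U n `&` V' n)); split.
- by apply: bigcup_open => n _; exact: openI.
- by apply: bigcup_open => n _; exact: openI.
- move=> x Ax; have : (~` B) x by move=> Bx; rewrite -[False]/(set0 x) -AB0.
  rewrite -UB => -[n _ U'x]; exists n => //; split=> //.
  apply: contrapT => /(UV n).2 Ux; suff : (~` A) x by exact.
  by rewrite -UA; exists n.+1.
- move=> x Bx; have : (~` A) x by move=> Ax; rewrite -[False]/(set0 x) -AB0.
  rewrite -UA => -[n _ Ux]; exists n => //; split=> //.
  apply: contrapT => /(UV' n).2 U'x; suff : (~` B) x by exact.
  by rewrite -UB; exists n.+1.
- rewrite -subset0 => x [[n _ [U'x Vx]] [m _ [Ux V'x]]].
  have [nm|/ltnW mn] := leqP n m.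
    by apply: ((UV' n).1 _ U'x); exact: (Seq_decreasing UV') V'x.
  by apply: ((UV m).1 _ Ux); exact: (Seq_decreasing UV) Vx.
Qed.

(** An open set is a countable union of members w_i of P, each with its Seq sequences. The n-th
    approximation unites the n-th U's of w_0, ..., w_n and intersects their n-th V's. *)
Lemma Seq_open_retop (X : choiceType) (P : set (set X)) :
  lattice_of_sets P -> countable P -> Seq_property P ->
  Seq_property (@open (retop P)).
Proof.
move=> [P0 PT PI PU] cP SeqP O /(open_retopP PT PI) oO.
have [||w wE] := @countable_enum _ [set W | P W /\ W `<=` O].
- by exists set0; split.
- by apply: sub_countable cP; apply: subset_card_le => W [].
have /choice[u /choice[v uv]] : forall i, exists U, exists V : nat -> set X,
    [/\ forall n, P (U n), forall n, P (V n),
     forall k, U k `<=` ~` V k /\ ~` V k `<=` U k.+1 & \bigcup_n U n = w i].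
  move=> i; apply: SeqP; have : range w (w i) by exists i.
  by rewrite wE => -[].
exists (fun n => \bigcup_(i in `I_n.+1) u i n).
exists (fun n => \bigcap_(i in `I_n.+1) v i n); split.
- move=> n; apply: bigcup_open => i _; apply: retop_open.
  by have [+ _ _ _] := uv i; apply.
- move=> n; rewrite bigcap_mkord; apply: big_ind => [||i _].
  + exact: openT.
  + by move=> A B; exact: openI.
  + by apply: retop_open; have [_ + _ _] := uv i; apply.
- move=> k; rewrite setC_bigcap; split=> [x [i ik ux]|x [i ik vx]].
    by exists i => //; have [_ _ /(_ k)[+ _] _] := uv i; apply.
  exists i; first exact: ltnW.
  by have [_ _ /(_ k)[_ +] _] := uv i; apply.
- have uO i n : u i n `<=` O.
    have : range w (w i) by exists i.
    rewrite wE => -[_ wO]; apply: subset_trans wO.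
    by have [_ _ _ <-] := uv i; exact: bigcup_sup.
  have um i n m : (n <= m)%N -> u i n `<=` u i m.
    by have [_ _ uvi _] := uv i; exact: Seq_increasing.
  apply/seteqP; split=> [x [n _ [i _]]|x]; first exact: uO.
  move=> /oO[U [PU' Ux UO]].
  have [i _ wi] : range w U by rewrite wE.
  have : w i x by rewrite wi.
  have [_ _ _ <-] := uv i; move=> [n _ ux].
  exists (maxn i n) => //; exists i; first by rewrite /= ltnS leq_maxl.
  by apply: um ux; rewrite leq_maxr.
Qed.

(** Urysohn's lemma for the complements of [W] and of V_n, where U_n contains [x]; they are disjoint
    since the complement of V_n lies in U_(n+1), hence in [W]. *)
Lemma retop_separation (R : realType) (X : choiceType) (P : set (set X)) W x :
  lattice_of_sets P -> countable P -> Seq_property P -> P W -> W x ->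
  exists h : X -> R, [/\ continuous (h : retop P -> R), h x != 0 &
    forall y, ~ W y -> h y = 0].
Proof.
move=> latP cP SeqP PW Wx.
have [U [V [PU PV UV UW]]] := SeqP _ PW.
have [n _ Ux] : (\bigcup_n U n) x by rewrite UW.
have : uniform_separator (~` W : set (retop P)) (~` V n).
  apply: normal_uniform_separator.
  - exact/(Seq_open_normal R)/Seq_open_retop.
  - by apply: open_closedC; exact: retop_open.
  - by apply: open_closedC; exact: retop_open.
  - rewrite -subset0 => y [nWy /(UV n).2 Uy]; apply: nWy.
    by rewrite -UW; exists n.+1.
move=> /(@uniform_separatorP _ R)[h [ch _ h0 h1]]; exists h; split=> //.
  have -> : h x = 1 by apply: h1; exists x => //; exact: (UV n).1.
  exact: oner_neq0.
by move=> y nWy; apply: h0; exists y.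
Qed.

(** * Maps having a given lattice as base *)

Section map_base.
Variables (R : realType) (X : topologicalType).

(** P is a base of Y up to preimages: continuity from [retop P] says, for a lattice P, that
    preimages of open sets are unions of members of P. *)
Definition map_base (Y : topologicalType) (f : X -> Y) (P : set (set X)) :=
  (forall U, P U -> exists2 O, open O & U = f @^-1` O) /\
  continuous (f : retop P -> Y).

(** A local form of Seq: P may be uncountable, while the separation by real functions works inside a
    countable sublattice. *)
Definition countably_Seq (P : set (set X)) := forall W, P W ->
  exists A : set (set X),
    [/\ A W, A `<=` P, lattice_of_sets A, countable A & Seq_property A].

(** The map is the diagonal of all real functions continuous for [retop P]. A member U of P is the
    union of the co-zero sets of those functions that vanish outside U, hence a preimage of an open
    set. *)
Lemma exists_map_base (P : set (set X)) : lattice_of_sets P -> P `<=` open ->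
  countably_Seq P -> exists phi : map_onto X, map_base phi P.
Proof.
move=> latP Po SeqP.
pose J := {h : X -> R | continuous (h : retop P -> R)}.
pose Y (_ : J) : topologicalType := R.
pose f (h : J) : X -> Y h := sval h.
have cf : continuous (diagonal_map f : retop P -> _).
  by apply: continuous_diagonal => -[h ch].
pose phi := MapOnto (retop_open_continuous latP Po cf) (diagonal_map_surjective f)
  (diagonal_tychonoff f R (fun=> tychonoff_realType R)).
exists phi; split=> // U PU.
exists (\bigcup_(h in [set h : J | forall y, ~ U y -> f h y = 0])
  ((fun z : map_image phi => set_val z h : R) @^-1` (~` [set 0]))).
  apply: bigcup_open => h _; apply: open_comp => [z _|].
    exact: (@diagonal_coord_continuous _ _ _ f h).
  by apply: closed_openC; exact: closed_eq.
apply/seteqP; split=> [x Ux|x [h hU /= hx]]; last first.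
  by apply: contrapT => /hU.
have [A [AU AP latA cA SeqA]] := SeqP _ PU.
have [h [ch hx hU]] := retop_separation R latA cA SeqA AU Ux.
exists (exist _ h (retop_subset_continuous latA latP AP ch)) => //.
exact/eqP.
Qed.

End map_base.

(** * Weight *)

Lemma infinite_weight (Y : topologicalType) : infinite_set (weight Y).
Proof.
rewrite /weight; case: ifPn => [natB|_].
  apply/infiniteP; rewrite (card_le_eqr (inj_card_eq _)) // => a b _ _.
  by case.
apply/infiniteP; rewrite (card_le_eqr (inj_card_eq _)) // => a b _ _.
by case.
Qed.

Lemma weight_basis (Y : topologicalType) :
  exists2 B : set (set Y), basis B & B #<= weight Y.
Proof.
have [B0 B0P] := least_base_neq0 Y.
have [bB _] := xgetI set0 B0P.
exists (xget set0 (least_base Y)) => //; rewrite /weight; case: ifPn => natB.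
  by rewrite (card_le_eqr (inj_card_eq _)) // => a b _ _; case.
rewrite (card_le_eqr (inj_card_eq _)); last by move=> a b _ _; case.
by apply/finite_set_countable/finite_setPn/negP.
Qed.

Lemma weight_le (Y : topologicalType) (B : set (set Y)) U (K : set U) :
  infinite_set K -> basis B -> B #<= K -> weight Y #<= K.
Proof.
move=> infK bB BK; have [B0 B0P] := least_base_neq0 Y.
have [_ minB] := xgetI set0 B0P.
rewrite /weight; case: ifPn => natB; apply: (card_le_trans (card_image_le _ _)).
  exact: card_le_trans (minB _ bB) BK.
exact/infiniteP.
Qed.

(** The open sets of Y whose preimage lies in P form a base; as f is onto, each is the image of its
    preimage, so there are at most |P| of them. *)
Lemma map_base_weight (X Y : topologicalType) (f : X -> Y) P U (K : set U) :
  range f = [set: Y] -> lattice_of_sets P -> map_base f P ->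
  infinite_set K -> P #<= K -> weight Y #<= K.
Proof.
move=> fT [_ PT PI _] [Pf /(continuous_retopP PT PI) cf] infK PK.
apply: (@weight_le _ [set O | open O /\ P (f @^-1` O)]) => //.
  split=> [O []//|y A]; rewrite nbhsE => -[O [oO Oy] OA].
  have : [set: Y] y by [].
  rewrite -fT => -[x _ fx]; rewrite -fx in Oy.
  have [W [PW Wx WO]] := cf _ _ oO Oy; have [G oG WG] := Pf _ PW.
  exists G.
    by split; [split; rewrite -?WG|rewrite -fx; move: Wx; rewrite WG].
  move=> z Gz; have : [set: Y] z by [].
  by rewrite -fT => -[t _ tz]; rewrite -tz; apply/OA/WO; rewrite WG /= tz.
apply: (card_le_trans _ PK); apply: (card_le_trans _ (card_image_le (fun W => f @` W) P)).
apply: subset_card_le => O [_ PO]; exists (f @^-1` O) => //.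
by rewrite image_preimage.
Qed.

(** For each pair (W, V) of members of B that admits a co-zero set between W and V, choose one; the
    chosen sets form a base indexed by a part of [B * B]. *)
Lemma coZ_basis (R : realType) (Y : topologicalType) (B : set (set Y)) U (K : set U) :
  completely_regular_space Y -> infinite_set K -> basis B -> B #<= K ->
  exists B', [/\ basis B', B' `<=` coZ R Y & B' #<= K].
Proof.
move=> crY infK [Bo bB] BK.
pose dom := [set p : set Y * set Y | (B `*` B) p /\
  exists G, [/\ coZ R Y G, p.1 `<=` G & G `<=` p.2]].
have /choice[G GP] : forall p, exists G, dom p ->
    [/\ coZ R Y G, p.1 `<=` G & G `<=` p.2].
  move=> p; have [[_ [G GP]]|nd] := pselect (dom p); first by exists G.
  by exists set0.
have GcoZ : G @` dom `<=` coZ R Y by move=> _ [p /GP[? _ _] <-].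
exists (G @` dom); split=> //.
- split=> [U' /GcoZ/coZ_open //|y A /bB[V [BV Vy] VA]].
  have [H [coZH Hy HV]] := coZ_nbhs R crY (Bo _ BV) Vy.
  have /bB[W [BW Wy] WH] : nbhs y H.
    by apply: open_nbhs_nbhs; split=> //; exact: coZ_open coZH.
  have dWV : dom (W, V) by split=> //; exists H.
  have [_ WG GV] := GP _ dWV.
  by exists (G (W, V)); [split; [exists (W, V)|exact: WG]|exact: subset_trans VA].
- apply: (card_le_trans (card_image_le _ _)).
  apply: (@card_le_trans _ _ _ (B `*` B)); first by apply: subset_card_le => p [].
  exact: card_le_trans (card_le_setX BK BK) (card_setX_infinite infK).
Qed.

Lemma lattice_generated_preimage (X Y : topologicalType) (f : X -> Y)
    (E : set (set X)) :
  (forall U, E U -> exists2 O, open O & U = f @^-1` O) ->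
  forall U, lattice_generated ([set set0; setT] `|` E) U ->
    exists2 O, open O & U = f @^-1` O.
Proof.
move=> Ef; apply: lattice_generated_ind => [U [[->|->]|/Ef//]||].
- by exists set0; [exact: open0|rewrite preimage_set0].
- by exists setT; [exact: openT|rewrite preimage_setT].
- move=> U V [O oO ->] [G oG ->]; exists (O `&` G); first exact: openI.
  by rewrite preimage_setI.
- move=> U V [O oO ->] [G oG ->]; exists (O `|` G); first exact: openU.
  by rewrite preimage_setU.
Qed.

Section map_base_diagonal.
Variables (X : topologicalType) (J : Type) (Y : J -> topologicalType).
Variables (f : forall a, X -> Y a) (P : J -> set (set X)).
Hypotheses (latP : forall a, lattice_of_sets (P a))
  (fP : forall a, map_base (f a) (P a)).

(** Q ranges between the union of the [P a] and the lattice it generates with the bounds, so that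
    both generated lattices and increasing unions of lattices are covered. *)
Lemma map_base_diagonal (Q : set (set X)) :
  lattice_of_sets Q -> (forall a, P a `<=` Q) ->
  Q `<=` lattice_generated ([set set0; setT] `|` \bigcup_a P a) ->
  map_base (diagonal_map f) Q.
Proof.
move=> latQ PQ QP; split; last first.
  apply: continuous_diagonal => a.
  exact: (retop_subset_continuous (latP a) latQ (PQ a) (fP a).2).
apply: (subset_trans QP); apply: lattice_generated_preimage => U [a _ PU].
have [O oO ->] := (fP a).1 _ PU; exists ((fun z => set_val z a) @^-1` O) => //.
by apply: open_comp => // z _; exact: (@diagonal_coord_continuous _ _ _ f a).
Qed.

End map_base_diagonal.

(** * From additive c-clubs to multiplicative lattices *)

(** Let V be a nonempty co-zero set inside U and let W, the preimage of an open O, be its witness.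
    Members of P inside W meet V, so every point of O is in the closure of the image of U. *)
Lemma map_base_skeletal (R : realType) (X Y : topologicalType) (f : X -> Y) P :
  completely_regular_space X -> range f = [set: Y] -> lattice_of_sets P ->
  map_base f P -> subset_c R P -> skeletal f.
Proof.
move=> crX fT [_ PT PI _] [Pf /(continuous_retopP PT PI) cf] [PcoZ Pc] U oU [x Ux].
have [V [coZV Vx VU]] := coZ_nbhs R crX oU Ux.
have [W [PW [w Ww] WP]] : exists W, [/\ P W, W !=set0 &
    forall U, P U -> U !=set0 -> U `<=` W -> U `&` V !=set0].
  by apply: Pc => //; exists x.
have [O oO WO] := Pf _ PW; exists (f w).
rewrite /interior nbhsE; exists O; first by split=> //; move: Ww; rewrite WO.
move=> y Oy A; rewrite nbhsE => -[G [oG Gy] GA].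
have : [set: Y] y by [].
rewrite -fT => -[z _ zy].
have OGz : (O `&` G) (f z) by rewrite zy.
have [T [PT' Tz TOG]] := cf _ _ (openI oO oG) OGz.
have [|v [Tv Vv]] := WP T PT' (ex_intro _ z Tz).
  by move=> t /TOG[]; rewrite WO.
exists (f v); split; first by exists v => //; exact: VU.
by apply: GA; have [] := TOG _ Tv.
Qed.

(** Points identified by [phi] lie in the same members of P, hence [f], whose image is T1,
    identifies them too. The factor is [f] after any section of [phi]. *)
Lemma map_prec_map_base (X : topologicalType) (phi f : map_onto X) P :
  lattice_of_sets P ->
  map_base phi P -> continuous ((f : X -> map_image f) : retop P -> _) ->
  map_prec phi f.
Proof.
move=> [_ PT PI _] [Pphi _] /(continuous_retopP PT PI) cf.
have fibers x x' : phi x = phi x' -> f x = f x'.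
  move=> xx'; apply: contrapT => /eqP /((map_tychonoff f).2 _ _)[A [oA fxA fx'A]].
  rewrite !inE in fxA fx'A.
  have [U [PU Ux UA]] := cf _ _ oA fxA; have [O oO UO] := Pphi _ PU.
  by apply/fx'A/UA; rewrite UO /= -xx'; move: Ux; rewrite UO.
have /choice[g gP] : forall z : map_image phi, exists x, phi x = z.
  move=> z; have : [set: map_image phi] z by [].
  by rewrite -(map_surjective phi) => -[x _ <-]; exists x.
exists (fun z => f (g z)); last first.
  by apply: funext => x /=; apply: fibers; rewrite gP.
apply/continuousP => O oO; rewrite openE => z Oz.
have [U [PU Uz UO]] := cf _ _ oO Oz; have [G oG UG] := Pphi _ PU.
rewrite /interior nbhsE; exists G.
  by split=> //; move: Uz; rewrite UG /= gP.
by move=> z' Gz'; apply: UO; rewrite UG /= gP.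
Qed.

Lemma map_base_basis (X Y : topologicalType) (f : X -> Y) (B : set (set Y)) :
  continuous f -> basis B ->
  map_base f (lattice_generated ([set set0; setT] `|` preimage f @` B)).
Proof.
move=> cf [Bo bB]; set P := lattice_generated _.
have [_ PT PI _] : lattice_of_sets P.
  exact: lattice_of_sets_generated01.
split; last first.
  apply/continuous_retopP => // O x oO Ofx.
  have /bB[U [BU Ufx] UO] : nbhs (f x) O by apply: open_nbhs_nbhs.
  exists (f @^-1` U); split=> //; last by move=> y /UO.
  by apply: sub_lattice_generated; right; exists U.
by apply: lattice_generated_preimage => _ [O BO <-]; exists O => //; exact: Bo.
Qed.

Lemma map_base_homeomorphic (X Y Z : topologicalType) (f : X -> Y) (g : X -> Z) P :
  homeomorphic_maps f g -> map_base f P -> map_base g P.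
Proof.
move=> [h [ch [k [ck hk kh]]] fE] [Pf cf]; split=> [U /Pf[O oO ->]|].
  exists (h @^-1` O); last by rewrite fE.
  by apply: open_comp => // z _; exact: ch.
have -> : g = k \o f by rewrite fE; apply: funext => x /=; rewrite hk.
by move=> x; exact: (@continuous_comp (retop P) _ _ f k x (cf x) (ck _)).
Qed.

(** The witness for V is a member of P inside the preimage of the interior of the closure of
    f(V). *)
Lemma skeletal_subset_c (R : realType) (X Y : topologicalType) (f : X -> Y) P :
  range f = [set: Y] -> lattice_of_sets P -> map_base f P -> P `<=` coZ R X ->
  skeletal f -> subset_c R P.
Proof.
move=> fT [_ PT PI _] [Pf /(continuous_retopP PT PI) cf] PcoZ skf.
split=> // V coZV V0; have [y yV] := skf _ (coZ_open coZV) V0.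
have : [set: Y] y by [].
rewrite -fT => -[x _ xy]; rewrite -xy in yV.
have [W [PW Wx WV]] := cf _ _ (open_interior _) yV.
exists W; split=> //; first by exists x.
move=> U PU [u Uu] UW; have [O oO UO] := Pf _ PU.
have /interior_subset/(_ O) : (closure (f @` V))° (f u) by exact/WV/UW.
have Ofu : nbhs (f u) O by apply: open_nbhs_nbhs; split=> //; move: Uu; rewrite UO.
by move=> /(_ Ofu)[_ [[v Vv <-] Ofv]]; exists v; rewrite UO.
Qed.

(** * Lattices local to an additive c-club *)

Section club_to_maps.
Variables (R : realType) (X : topologicalType) (C : set (set (set X))).
Hypothesis clubC : additive_c_club R C.

Let C_coZ E : C E -> E `<=` coZ R X.
Proof. by have [[[h _ _] _] _] := clubC => /h[]. Qed.

Let C_countable E : C E -> countable E.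
Proof. by have [[[h _ _] _] _] := clubC => /h[_ En]; rewrite (eq_countable En). Qed.

Let C_Seq E : C E -> Seq_property E.
Proof. by have [[_ h] _] := clubC => /h[]. Qed.

Let C_c E : C E -> subset_c R E.
Proof. by have [[_ h] _] := clubC => /h[]. Qed.

Let C_lattice E : C E -> lattice_of_sets E.
Proof.
move=> CE; have [[[h _ _] h'] _] := clubC; have [_ SeqE EU EI] := h' _ CE.
apply: Seq_lattice_of_sets => //; have [_ En] := h _ CE.
exact/infinite_setN0/infinite_set_card_nat.
Qed.

(* The exemption of set0 and setT is needed for the empty diagonal product. *)
Definition club_local (P : set (set X)) := forall b, P b ->
  [\/ b = set0, b = setT | exists E, [/\ C E, E b & E `<=` P]].

(** Additivity amalgamates witnesses: two members of the club inside [Q] generate a member that is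
    still inside [Q], and it contains the meets and joins of their elements. *)
Lemma club_local_generated I (F : I -> set (set X)) :
  (forall i, club_local (F i)) ->
  club_local (lattice_generated ([set set0; setT] `|` \bigcup_i F i)).
Proof.
move=> Floc; set Q := lattice_generated _.
have join E E' : C E -> C E' -> E `<=` Q -> E' `<=` Q ->
    exists E'', [/\ C E'', E `<=` E'', E' `<=` E'' & E'' `<=` Q].
  move=> CE CE' EQ E'Q; exists (lattice_generated (E `|` E')); split.
  - by have [_ h] := clubC; exact: h.
  - by move=> x Ex; apply: sub_lattice_generated; left.
  - by move=> x Ex; apply: sub_lattice_generated; right.
  - apply: lattice_generated_ind.
    + by move=> U [/EQ|/E'Q].
    + exact: lattice_generated_setI.
    + exact: lattice_generated_setU.
apply: lattice_generated_ind => [U [[->|->]|[i _ FU]]|U V hU hV|U V hU hV].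
- exact: Or31.
- exact: Or32.
- have [->|->|[E [CE EU EF]]] := Floc _ _ FU; [exact: Or31|exact: Or32|].
  apply: Or33; exists E; split=> //; apply: (subset_trans EF) => W FW.
  by apply: sub_lattice_generated; right; exists i.
- case: hU => [->|->|[E [CE EU EQ]]]; [by rewrite set0I; exact: Or31|by rewrite setTI|].
  case: hV => [->|->|[E' [CE' EV EQ']]]; [by rewrite setI0; exact: Or31| |].
    by rewrite setIT; apply: Or33; exists E.
  have [E'' [CE'' EE EE' EQ'']] := join _ _ CE CE' EQ EQ'.
  apply: Or33; exists E''; split=> //; have [_ _ EI _] := C_lattice CE''.
  by apply: EI; [exact: EE|exact: EE'].
- case: hU => [->|->|[E [CE EU EQ]]]; [by rewrite set0U|by rewrite setTU; exact: Or32|].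
  case: hV => [->|->|[E' [CE' EV EQ']]]; [|by rewrite setUT; exact: Or32|].
    by rewrite setU0; apply: Or33; exists E.
  have [E'' [CE'' EE EE' EQ'']] := join _ _ CE CE' EQ EQ'.
  apply: Or33; exists E''; split=> //; have [_ _ _ EI] := C_lattice CE''.
  by apply: EI; [exact: EE|exact: EE'].
Qed.

Section club_local.
Variable P : set (set X).
Hypotheses (latP : lattice_of_sets P) (locP : club_local P).

Lemma club_local_coZ : P `<=` coZ R X.
Proof.
move=> b /locP[->|->|[E [/C_coZ + Eb _]]]; first exact: coZ0.
  exact: coZT.
exact.
Qed.

Lemma club_local_Seq : countably_Seq P.
Proof.
(* The bounds are served by the two-element lattice, which has Seq with constant sequences since its
   elements are complements of each other. *)
have trivial : [/\ [set set0; setT] `<=` P, lattice_of_sets [set set0; [set: X]],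
    countable [set set0; [set: X]] & Seq_property [set set0; [set: X]]].
  split.
  - by have [P0 PT _ _] := latP; move=> _ [->|->].
  - split; [by left|by right| |].
      by move=> _ _ [->|->] [->|->]; rewrite ?setI0 ?set0I ?setIT; [left..|right].
    by move=> _ _ [->|->] [->|->]; rewrite ?setU0 ?set0U ?setUT ?setTU; [left|right..].
  - exact/finite_set_countable/finite_set2.
  - move=> W WP; exists (fun=> W), (fun=> ~` W); split=> //.
    + by move=> _; case: WP => ->; rewrite ?setC0 ?setCT; [right|left].
    + by move=> _; rewrite setCK; split.
    + by apply/seteqP; split=> [x []|x Wx]//; exists 0%N.
move=> W /locP[->|->|[E [CE EW EP]]].
- by case: trivial => *; exists [set set0; setT]; split=> //; left.
- by case: trivial => *; exists [set set0; setT]; split=> //; right.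
- exists E; split=> //; [exact: C_lattice|exact: C_countable|exact: C_Seq].
Qed.

(** The elements of S are swallowed one at a time: additivity adjoins a club member around each, and
    the club contains the union of the resulting increasing sequence. *)
Lemma club_local_absorb A S : C A -> A `<=` P -> countable S -> S `<=` P ->
  exists A', [/\ C A', A `<=` A', S `<=` A' & A' `<=` P].
Proof.
move=> CA AP cS SP; have [S0|/set0P S0] := eqVneq S set0.
  by exists A; split=> //; rewrite S0; exact: sub0set.
have [e eS] := countable_enum S0 cS.
(* When [e n] is a bound, [A] itself is taken as [E]: every member of the club contains both
   bounds. *)
have /choice[E EP] : forall n, exists E,
    [/\ C E, E `<=` P & forall B, C B -> E `<=` B -> B (e n)].
  move=> n; have : S (e n) by rewrite -eS; exists n.
  move=> /SP/locP[->|->|[E [CE Ee EP]]].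
  - by exists A; split=> // B /C_lattice[].
  - by exists A; split=> // B /C_lattice[].
  - by exists E; split=> // B _; apply.
pose F := fix F n := if n is n'.+1 then lattice_generated (F n' `|` E n') else A.
have FC n : C (F n) /\ F n `<=` P.
  elim: n => [//|n [CF FP]] /=; have [CE EnP _] := EP n; split.
    by have [_ h] := clubC; exact: h.
  have [_ _ PI PU] := latP.
  by apply: lattice_generated_ind => // U [/FP|/EnP].
have FS n : F n `<=` F n.+1.
  by move=> U FU; apply: sub_lattice_generated; left.
exists (\bigcup_n F n); split.
- by have [[[_ h _] _] _] := clubC; apply: h => // n; exact: (FC n).1.
- by move=> U AU; exists 0%N.
- move=> s; rewrite -eS => -[n _ <-]; exists n.+1 => //.
  have [_ _ ] := EP n; apply; first exact: (FC n.+1).1.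
  by move=> U EU; apply: sub_lattice_generated; right.
- by move=> U [n _]; exact: (FC n).2.
Qed.

(* If no W witnesses the condition for V, then closing off under a choice, for
   each nonempty W, of a nonempty U inside W that misses V yields a member of C
   for which the condition fails. *)
Lemma club_local_subset_c : subset_c R P.
Proof.
split=> [|V coZV V0]; first exact: club_local_coZ.
apply: contrapT => noW.
have /choice[u uP] : forall W, exists U, P W -> W !=set0 ->
    [/\ P U, U !=set0, U `<=` W & U `&` V = set0].
  move=> W; apply: contrapT => noU; apply: noW; exists W.
  have PW : P W by apply: contrapT => nPW; apply: noU; exists W.
  have W0 : W !=set0 by apply: contrapT => nW0; apply: noU; exists W.
  split=> // U PU U0 UW; apply/set0P/eqP => UV; apply: noU; exists U.
  by split.
have [x Vx] := V0.
have [P0 PT _ _] := latP.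
(* The set [u setT] is nonempty and misses the nonempty V, so it is neither bound; locality then
   yields a first member of the club inside P. *)
have [PuT [y uTy] _ uTV] := uP setT PT (ex_intro _ x I).
have [A0 [CA0 A0P]] : exists A, C A /\ A `<=` P.
  have [uT0|uTT|[E [CE _ EP]]] := locP PuT.
  - by move: uTy; rewrite uT0.
  - by move: uTV; rewrite uTT setTI => VE; move: Vx; rewrite VE.
  - by exists E.
have /choice[step stepP] : forall A, exists A', C A /\ A `<=` P ->
    [/\ C A', A `<=` A', forall W, A W -> W !=set0 -> A' (u W) & A' `<=` P].
  move=> A; have [[CA AP]|nA] := pselect (C A /\ A `<=` P); last first.
    by exists A.
  have [||A' [CA' AA' uA' A'P]] :=
      @club_local_absorb A (u @` [set W | A W /\ W !=set0]) CA AP.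
  - apply: (card_le_trans (card_image_le _ _)).
    by apply: sub_countable (C_countable CA); apply: subset_card_le => W [].
  - by move=> _ [W [/AP PW W0] <-]; have [] := uP _ PW W0.
  - by exists A'; split=> // W AW W0; apply: uA'; exists W.
pose F n := iter n step A0.
have FC n : C (F n) /\ F n `<=` P.
  by elim: n => [//|n /stepP[]].
have CF : C (\bigcup_n F n).
  have [[[_ h _] _] _] := clubC; apply: h => n; first exact: (FC n).1.
  by have [] := stepP _ (FC n).
have [_ /(_ _ coZV V0)[W [[n _ FW] W0 WV]]] := C_c CF.
have PW : P W by exact: (FC n).2.
have [PuW uW0 uWW uWV] := uP _ PW W0.
have : u W `&` V !=set0.
  apply: WV => //; exists n.+1 => //.
  by have [_ _ h _] := stepP _ (FC n); exact: h.
by rewrite uWV => -[].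
Qed.

End club_local.

Lemma club_skeletally_dugundji : tychonoff_space X -> skeletally_dugundji X.
Proof.
move=> tychX.
pose Psi (phi : map_onto X) := exists P : set (set X),
  [/\ lattice_of_sets P, club_local P & map_base phi P].
exists Psi; last first.
  move=> phi [P [latP locP baseP]].
  apply: (map_base_skeletal tychX.1 (map_surjective phi) latP baseP).
  exact: club_local_subset_c.
have latQ I (F : I -> set (set X)) :
    lattice_of_sets (lattice_generated ([set set0; setT] `|` \bigcup_i F i)).
  exact: lattice_of_sets_generated01.
split=> [f|J phi Psiphi].
  have infK := @infinite_weight (map_image f).
  have [B0 bB0 B0K] := weight_basis (map_image f).
  have [B [[Bo bB] BcoZ BK]] := coZ_basis R (map_tychonoff f).1 infK bB0 B0K.
  (* One countable club member around the preimage of each set of a small co-zero base: the lattice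
     they generate refines [f] and has at most weight-many elements. *)
  have /choice[E EP] : forall G : set_type B, exists E, C E /\ E (f @^-1` \val G).
    move=> G; have [[[_ _ h] _] _] := clubC.
    have [||E CE EG] := h [set f @^-1` \val G].
    - move=> _ ->; apply: coZ_preimage; first exact: map_continuous.
      by apply: BcoZ; exact: set_valP.
    - exact: countable1.
    - by exists E; split=> //; exact: EG.
  pose Q := lattice_generated ([set set0; setT] `|` \bigcup_G E G).
  have locE G : club_local (E G).
    by move=> b Eb; apply: Or33; exists (E G); split=> //; have [] := EP G.
  have locQ := club_local_generated locE.
  have Qo : Q `<=` open by move=> U /(club_local_coZ locQ)/coZ_open.
  have [phi basephi] := exists_map_base R (latQ _ E) Qo (club_local_Seq (latQ _ E) locQ).
  have [_ QT QI _] := latQ _ E.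
  exists phi; split.
  - by exists Q; split=> //; exact: latQ.
  - apply: (map_prec_map_base (latQ _ E) basephi); apply/continuous_retopP => //.
    move=> O x oO Ofx.
    have /bB[G [BG Gfx] GO] : nbhs (f x) O by apply: open_nbhs_nbhs.
    have [_ EG] := EP (SigSub (mem_set BG)).
    exists (f @^-1` G); split=> //; last by move=> y /GO.
    by apply: sub_lattice_generated; right; exists (SigSub (mem_set BG)).
  - apply: (map_base_weight (map_surjective phi) (latQ _ E) basephi infK).
    have KK := card_setX_infinite infK.
    have countK (S : set (set X)) : countable S -> S #<= weight (map_image f).
      by move=> cS; apply: (card_le_trans cS); exact/infiniteP.
    apply: card_lattice_generated => //; apply: card_leU => //.
      exact/countK/finite_set_countable/finite_set2.
    apply: card_le_bigcup => // [|G _]; last by apply/countK/C_countable; have [] := EP G.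
    apply: (@card_le_trans _ _ _ B) => //.
    by have := card_setT B; rewrite card_eq_le => /andP[].
have /choice[P PP] := Psiphi.
pose f a : X -> map_image (phi a) := phi a.
have latP a : lattice_of_sets (P a) by have [] := PP a.
have baseP a : map_base (f a) (P a) by have [] := PP a.
have locQ : club_local (lattice_generated ([set set0; setT] `|` \bigcup_a P a)).
  by apply: club_local_generated => a; have [] := PP a.
have PQ a : P a `<=` lattice_generated ([set set0; setT] `|` \bigcup_a P a).
  by move=> U PU; apply: sub_lattice_generated; right; exists a.
have baseQ := map_base_diagonal latP baseP (latQ _ P) PQ (@subset_refl _ _).
have Qo : lattice_generated ([set set0; setT] `|` \bigcup_a P a) `<=` open.
  by move=> U /(club_local_coZ locQ)/coZ_open.
have cf := retop_open_continuous (latQ _ P) Qo baseQ.2.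
exists (MapOnto cf (diagonal_map_surjective f)
  (diagonal_tychonoff f R (fun a => map_tychonoff (phi a)))).
  by exists (lattice_generated ([set set0; setT] `|` \bigcup_a P a)).
exists id => //; split; first by move=> x; exact: cvg_id.
by exists id; split=> // x; exact: cvg_id.
Qed.

End club_to_maps.

(** * From multiplicative lattices to additive c-clubs *)

Section maps_to_club.
Variables (R : realType) (X : topologicalType) (Psi : map_onto X -> Prop).
Hypotheses (tychX : tychonoff_space X) (infX : infinite_set [set: X])
  (latPsi : multiplicative_lattice Psi)
  (skPsi : forall phi, Psi phi -> skeletal phi).

Definition lattice_club : set (set (set X)) := [set P |
  [/\ P `<=` coZ R X, P #= [set: nat], lattice_of_sets P, Seq_property P &
      exists2 phi, Psi phi & map_base phi P]].

(** The second lattice axiom gives a member of [Psi] homeomorphic to the diagonal product of the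
    maps based on the [P a], and having Q as base passes along the homeomorphism. *)
Lemma lattice_club_union (J : Type) (P : J -> set (set X)) (Q : set (set X)) :
  (forall a, lattice_club (P a)) -> lattice_of_sets Q ->
  (forall a, P a `<=` Q) ->
  Q `<=` lattice_generated ([set set0; setT] `|` \bigcup_a P a) ->
  exists2 phi, Psi phi & map_base phi Q.
Proof.
move=> CP latQ PQ QP.
have /choice[phi phiP] : forall a, exists phi, Psi phi /\ map_base phi (P a).
  by move=> a; have [_ _ _ _ [phi ? ?]] := CP a; exists phi.
have [psi Psipsi hpsi] := latPsi.2 J phi (fun a => (phiP a).1).
exists psi => //; apply: map_base_homeomorphic hpsi _.
pose f a : X -> map_image (phi a) := phi a.
have latP a : lattice_of_sets (P a) by have [] := CP a.
exact: (@map_base_diagonal X J _ f P latP (fun a => (phiP a).2) Q latQ PQ QP).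
Qed.

(** Functions defining the sets of B have a diagonal of countable weight, and the first lattice
    axiom gives [phi] in [Psi] of countable weight through which it factors. The member sought is
    pulled back along [phi] from a countable Seq lattice of co-zero sets of the image. *)
Lemma lattice_club_cofinal (B : set (set X)) : B `<=` coZ R X -> countable B ->
  exists2 A, lattice_club A & B `<=` A.
Proof.
move=> BcoZ cB.
(* Adjoining [N] makes the resulting family infinite even when [B] is finite. *)
have [N [NcoZ infN Nnat]] :=
  infinite_countable_subset (infinite_coZ (R := R) tychX infX).
pose B' := B `|` N.
have cB' : countable B' by apply: countableU => //; rewrite (eq_countable Nnat).
have B'coZ : B' `<=` coZ R X by move=> U [/BcoZ|/NcoZ].
have /choice[F FP] : forall b : set_type B', exists f : X -> R,
    continuous f /\ \val b = [set x | f x != 0].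
  by move=> b; have [f cf bE] := B'coZ _ (set_valP b); exists f.
have [G cG bG] := @second_countable_realType R.
pose P (b : set_type B') := lattice_generated ([set set0; setT] `|` preimage (F b) @` G).
have latP b : lattice_of_sets (P b).
  exact: lattice_of_sets_generated01.
have baseP b : map_base (F b) (P b) by apply: map_base_basis => //; exact: (FP b).1.
pose Q := lattice_generated ([set set0; setT] `|` \bigcup_b P b).
have latQ : lattice_of_sets Q.
  exact: lattice_of_sets_generated01.
have c2 : countable [set set0; [set: X]] by exact/finite_set_countable/finite_set2.
have cQ : countable Q.
  apply: card_lattice_generated; first exact: infinite_nat.
  apply: countableU => //; apply: bigcup_countable => [|b _].
    by have := card_setT B' => /eq_countable ->.
  apply: card_lattice_generated; first exact: infinite_nat.
  by apply: countableU => //; exact: sub_countable (card_image_le _ _) _.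
have PQ b : P b `<=` Q by move=> U PU; apply: sub_lattice_generated; right; exists b.
have baseQ := map_base_diagonal latP baseP latQ PQ (@subset_refl _ _).
have cf : continuous (diagonal_map F).
  by apply: continuous_diagonal => b; exact: (FP b).1.
pose f := MapOnto cf (diagonal_map_surjective F)
  (diagonal_tychonoff F R (fun=> tychonoff_realType R)).
have [phi [Psiphi [g cg gE] wphi]] := latPsi.1 f.
have wf : weight (map_image f) #<= [set: nat].
  exact: (map_base_weight (map_surjective f) latQ baseQ infinite_nat cQ).
have [D0 bD0 D0w] := weight_basis (map_image phi).
have cD0 : D0 #<= [set: nat] := card_le_trans D0w (card_le_trans wphi wf).
have [D [bD DcoZ cD]] := coZ_basis R (map_tychonoff phi).1 infinite_nat bD0 cD0.
(* Since the function defining [b] factors through [phi], the set [b] is the preimage of a co-zero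
   set of the image. *)
pose pull (b : set_type B') : set (map_image phi) :=
  [set y | (set_val (g y) b : R) != 0].
have pullE b : phi @^-1` (pull b) = \val b.
  rewrite (FP b).2; apply/seteqP.
  have fE x : set_val (g (phi x)) b = F b x by rewrite -[g (phi x)]/((g \o phi) x) -gE.
  by split=> x; rewrite /pull /= fE.
have pull_coZ b : coZ R _ (pull b).
  exists (fun y => set_val (g y) b : R) => // y.
  exact: (@continuous_comp _ _ _ g (fun z => set_val z b) y (cg y)
    (@diagonal_coord_continuous _ _ _ F b _)).
have latcoZ : lattice_of_sets (coZ R (map_image phi)).
  by split; [exact: coZ0|exact: coZT|exact: coZ_setI|exact: coZ_setU].
(* [D] makes the lattice a base of the image of [phi], and the sets [pull b] make its preimage
   contain [B']. *)
have [||T [DT TcoZ cT latT SeqT]] :=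
    @Seq_closure _ (D `|` range pull) _ latcoZ (@Seq_coZ R _).
- apply: countableU => //; apply: (sub_countable (card_image_le _ _)).
  by have := card_setT B' => /eq_countable ->.
- by move=> U [/DcoZ|[b _ <-]].
pose A := preimage phi @` T.
have BA : B' `<=` A.
  move=> b Bb; exists (pull (SigSub (mem_set Bb))).
    by apply: DT; right; exists (SigSub (mem_set Bb)).
  by rewrite pullE.
have cA : countable A by apply: (sub_countable (card_image_le _ _)).
have infA : infinite_set A by apply: sub_infinite_set infN => U NU; apply: BA; right.
have latA : lattice_of_sets A.
  have [T0 TT TI TU] := latT; split.
  - by exists set0; rewrite ?preimage_set0.
  - by exists setT; rewrite ?preimage_setT.
  - by move=> _ _ [U TU' <-] [V TV <-]; exists (U `&` V); [exact: TI|rewrite preimage_setI].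
  - by move=> _ _ [U TU' <-] [V TV <-]; exists (U `|` V); [exact: TU|rewrite preimage_setU].
exists A; last by move=> U BU; apply: BA; left.
split=> //.
- by move=> _ [U TU <-]; apply: coZ_preimage; [exact: map_continuous|exact: TcoZ].
- exact: eq_card_nat.
- move=> _ [W TW <-]; have [U [V [TU TV UV UW]]] := SeqT _ TW.
  exists (fun n => phi @^-1` U n), (fun n => phi @^-1` V n); split.
  + by move=> n; exists (U n).
  + by move=> n; exists (V n).
  + by move=> k; split=> x /=; [exact: (UV k).1|exact: (UV k).2].
  + by rewrite -preimage_bigcup UW.
- exists phi => //; split=> [_ [U TU <-]|].
    by exists U => //; exact: coZ_open (TcoZ _ TU).
  have [_ AT AI _] := latA; apply/(continuous_retopP AT AI) => O x oO Ox.
  have /bD.2[U [DU Ux] UO] : nbhs (phi x) O by apply: open_nbhs_nbhs.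
  exists (phi @^-1` U); split=> //; last by move=> y /UO.
  by exists U => //; apply: DT; left.
Qed.

(** Increasing unions rest on diagonal products indexed by [nat], lattices generated by two members
    on those indexed by [bool]; skeletality of the maps in [Psi] yields [subset_c]. *)
Lemma lattice_club_additive : additive_c_club R lattice_club.
Proof.
split; [split; [split|]|].
- by move=> A [].
- move=> A CA mono.
  have leA n m : (n <= m)%N -> A n `<=` A m.
    move=> /subnK <-; elim: (m - n)%N => [//|k IH].
    by rewrite addSn => U /IH /mono.
  have latA : lattice_of_sets (\bigcup_n A n).
    have [_ _ [A0 AT _ _] _ _] := CA 0%N.
    split; [by exists 0%N|by exists 0%N| |].
      move=> U V [n _ AU] [m _ AV]; exists (maxn n m) => //.
      have [_ _ [_ _ AI _] _ _] := CA (maxn n m).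
      by apply: AI; [apply: leA AU; rewrite leq_maxl|apply: leA AV; rewrite leq_maxr].
    move=> U V [n _ AU] [m _ AV]; exists (maxn n m) => //.
    have [_ _ [_ _ _ AI] _ _] := CA (maxn n m).
    by apply: AI; [apply: leA AU; rewrite leq_maxl|apply: leA AV; rewrite leq_maxr].
  split=> //.
  + by move=> U [n _]; have [+ _ _ _ _] := CA n; apply.
  + apply: eq_card_nat.
      apply: bigcup_countable => // n _.
      by have [_ /eq_countable -> _ _ _] := CA n.
    have [_ A0 _ _ _] := CA 0%N.
    apply: (@sub_infinite_set _ (A 0%N)); first by move=> U AU; exists 0%N.
    exact: infinite_set_card_nat.
  + move=> W [n _ AW]; have [_ _ _ /(_ _ AW)[U [V [AU AV UV UW]]] _] := CA n.
    by exists U, V; split=> // k; exists n.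
  + apply: lattice_club_union latA _ _ => //; first by move=> n U AU; exists n.
    by move=> U AU; apply: sub_lattice_generated; right.
- exact: lattice_club_cofinal.
- move=> P [PcoZ _ latP SeqP [phi Psiphi baseP]]; have [_ _ PI PU] := latP.
  split=> //; apply: (skeletal_subset_c _ latP baseP) => //.
    exact: map_surjective.
  exact: skPsi.
- move=> A1 A2 CA1 CA2; set Q := lattice_generated _.
  have [coZ1 nat1 lat1 Seq1 _] := CA1; have [coZ2 nat2 lat2 Seq2 _] := CA2.
  have latQ : lattice_of_sets Q.
    by have [? ? _ _] := lat1; apply: lattice_of_sets_generated; left.
  split=> //.
  + apply: lattice_generated_ind => [U [/coZ1|/coZ2]//||].
      exact: coZ_setI.
    exact: coZ_setU.
  + apply: eq_card_nat.
      apply: card_lattice_generated; first exact: infinite_nat.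
      by apply: countableU; [rewrite (eq_countable nat1)|rewrite (eq_countable nat2)].
    apply: (@sub_infinite_set _ A1).
      by move=> U AU; apply: sub_lattice_generated; left.
    exact: infinite_set_card_nat.
  + apply: Seq_lattice_generated => W [/Seq1|/Seq2] [U [V [AU AV UV UW]]].
      by exists U, V; split=> // n; left.
    by exists U, V; split=> // n; right.
  + apply: (@lattice_club_union bool (fun b => if b then A1 else A2)) => //.
    * by case.
    * by case=> U AU; apply: sub_lattice_generated; [left|right].
    * apply: lattice_generated_ind.
      - move=> U [AU|AU]; apply: sub_lattice_generated; right;
          [by exists true|by exists false].
      - exact: lattice_generated_setI.
      - exact: lattice_generated_setU.
Qed.

End maps_to_club.

Theorem corollary11 (R : realType) (X : topologicalType)
  (tychX : tychonoff_space X) (infX : infinite_set [set: X]) :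
  skeletally_dugundji X <->
  exists C : set (set (set X)), additive_c_club R C.
Proof.
split=> [[Psi latPsi skPsi]|[C clubC]].
  by exists (lattice_club R Psi); exact: lattice_club_additive.
exact: club_skeletally_dugundji clubC tychX.
Qed.
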